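(* Let $\mathcal G$ and $\mathcal H$ be Lie groupoids and let $X$ be a biprincipal diffeological $(\mathcal G,\mathcal H)$-bibundle. Then $X$ is a biprincipal bibundle in the Lie sense. That is, a diffeological Morita equivalence between two Lie groupoids via diffeological bibundles is a Lie Morita equivalence via a bibundle in the Lie groupoid sense.
   Context: Diffeology. A parametrisation of a set $X$ is a map $p\colon U_p\to X$ from an open subset $U_p$ of some $\mathbb{R}^n$, $n\ge 0$. A diffeology on $X$ is a set of parametrisations, called plots, containing all constant parametrisations, such that a parametrisation that restricts to a plot on each member of an open cover of its domain is a plot, and such that $p\circ f$ is a plot for every plot $p$ and every smooth map $f\colon V\to U_p$ from an open subset $V$ of some $\mathbb{R}^m$. A map $F\colon X\to Y$ of diffeological spaces is smooth if $F\circ p$ is a plot of $Y$ for every plot $p$ of $X$; a diffeomorphism is a smooth bijection with smooth inverse. A subset of $X$ carries the plots of $X$ with image in it; products carry the parametrisations whose components are plots; fibre products $X\times_{f,g}Y=\{(x,y):f(x)=g(y)\}$ carry the subset diffeology of the product. A smooth surjection $F\colon X\to Y$ is a subduction if for every plot $p$ of $Y$ there are an open cover $\{U_\alpha\}$ of $U_p$ and plots $q_\alpha\colon U_\alpha\to X$ with $p|_{U_\alpha}=F\circ q_\alpha$. Smooth manifolds are regarded as diffeological spaces whose plots are the smooth parametrisations; a diffeological space ''is a manifold'' if its diffeology arises in this way from a (necessarily unique) smooth manifold structure. Groupoids. A diffeological groupoid $\mathcal G=(\mathcal G_1\rightrightarrows\mathcal G_0)$ is a small groupoid whose sets of objects $\mathcal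 G_0$ and arrows $\mathcal G_1$ are diffeological spaces such that the source $s$, target $t$, unit $x\mapsto u_x$, multiplication ($gh$ defined when $s(g)=t(h)$) and inversion are smooth. A Lie groupoid is a diffeological groupoid with $\mathcal G_0$ a (Hausdorff, second-countable) smooth manifold, $\mathcal G_1$ a smooth manifold not required to be Hausdorff or second-countable, and $s,t$ submersions. Bibundles. A left action of $\mathcal G$ on a diffeological space $X$ with smooth anchor $l\colon X\to\mathcal G_0$ is a smooth map $\mathcal G_1\times_{s,l}X\to X$, $(g,x)\mapsto gx$, with $l(gx)=t(g)$, $g'(gx)=(g'g)x$, $u_{l(x)}x=x$. A right action of $\mathcal H$ with smooth anchor $r\colon X\to\mathcal H_0$ is a smooth map $X\times_{r,t}\mathcal H_1\to X$ with $r(xh)=s(h)$, $(xh)h'=x(hh')$, $xu_{r(x)}=x$. A diffeological $(\mathcal G,\mathcal H)$-bibundle is a diffeological space $X$ with a left $\mathcal G$-action with anchor $l_X$ and a right $\mathcal H$-action with anchor $r_X$ such that $l_X$ is $\mathcal H$-invariant, $r_X$ is $\mathcal G$-invariant and the actions commute. It is right principal if $l_X\colon X\to\mathcal G_0$ is a subduction and $X\times_{r_X,t}\mathcal H_1\to X\times_{l_X,l_X}X$, $(x,h)\mapsto(x,xh)$, is a diffeomorphism; left principal if $r_X\colon X\to\mathcal H_0$ is a subduction and $\mathcal G_1\times_{s,l_X}X\to X\times_{r_X,r_X}X$, $(g,x)\mapsto(gx,x)$, is a diffeomorphism; biprincipal if both. A diffeological Morita equivalence via bibundles is a biprincipal diffeological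 bibundle. For Lie groupoids $\mathcal G,\mathcal H$, such a bibundle is biprincipal in the Lie sense if $X$ is a smooth manifold (as for arrow spaces of Lie groupoids, not required to be Hausdorff or second-countable), $l_X$ and $r_X$ are surjective submersions, the actions are smooth maps of manifolds, and the two maps $(x,h)\mapsto(x,xh)$ and $(g,x)\mapsto(gx,x)$ above are diffeomorphisms of manifolds. A Lie Morita equivalence via bibundles is such a bibundle. *)

(* Defs.v *)
From HB Require Import structures.
From mathcomp Require Import all_boot all_order all_algebra.
From mathcomp Require Import all_classical all_reals all_analysis.

Set Implicit Arguments.
Unset Strict Implicit.
Unset Printing Implicit Defensive.

Import Order.TTheory GRing.Theory Num.Theory.
Import numFieldNormedType.Exports.

Local Open Scope classical_set_scope.
Local Open Scope ring_scope.

(* Partial maps are represented by total functions of which only the values on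
   the indicated domain [U] matter. *)

Fixpoint iter_partial (R : realType) (n m : nat) (f : 'rV[R]_n -> 'rV[R]_m)
    (s : seq 'I_n) : 'rV[R]_n -> 'rV[R]_m :=
  if s is i :: s' then fun x => 'D_(delta_mx 0 i) (iter_partial f s') x else f.

(* All iterated partial derivatives exist and are continuous at every point of
   [U]; meaningful for open [U] only. *)
Definition smooth_on (R : realType) (n m : nat) (U : set 'rV[R]_n)
    (f : 'rV[R]_n -> 'rV[R]_m) : Prop :=
  forall (s : seq 'I_n) (x : 'rV[R]_n), U x ->
    {for x, continuous (iter_partial f s)} /\
    (forall i : 'I_n, derivable (iter_partial f s) x (delta_mx 0 i)).

(* [plot U p] says that the restriction of [p] to [U] is a plot; [plot_ext]
   makes this independent of the values of [p] outside [U]. *)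
Record diffspace (R : realType) := DiffSpace {
  carrier :> Type;
  plot : forall n : nat, set 'rV[R]_n -> ('rV[R]_n -> carrier) -> Prop;
  plot_open : forall n (U : set 'rV[R]_n) (p : 'rV[R]_n -> carrier),
    plot U p -> open U;
  plot_ext : forall n (U : set 'rV[R]_n) (p q : 'rV[R]_n -> carrier),
    (forall x, U x -> p x = q x) -> plot U p -> plot U q;
  plot_cst : forall n (U : set 'rV[R]_n) (a : carrier),
    open U -> plot U (fun=> a);
  plot_local : forall n (C : set (set 'rV[R]_n)) (p : 'rV[R]_n -> carrier),
    (forall V, C V -> open V /\ plot V p) -> plot (\bigcup_(V in C) V) p;
  plot_comp : forall n m (U : set 'rV[R]_n) (p : 'rV[R]_n -> carrier)
      (V : set 'rV[R]_m) (f : 'rV[R]_m -> 'rV[R]_n),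
    plot U p -> open V -> smooth_on V f -> f @` V `<=` U -> plot V (p \o f)
}.

Definition diff_smooth (R : realType) (X Y : diffspace R) (F : X -> Y) : Prop :=
  forall n (U : set 'rV[R]_n) (p : 'rV[R]_n -> X), plot U p -> plot U (F \o p).

Definition diffeomorphism (R : realType) (X Y : diffspace R) (F : X -> Y) :
    Prop :=
  diff_smooth F /\
  exists2 F' : Y -> X, diff_smooth F' & cancel F F' /\ cancel F' F.

Definition subduction (R : realType) (X Y : diffspace R) (F : X -> Y) : Prop :=
  [/\ diff_smooth F, (forall y, exists x, F x = y) &
    forall n (U : set 'rV[R]_n) (p : 'rV[R]_n -> Y), plot U p ->
      exists2 C : set (set 'rV[R]_n), U = \bigcup_(V in C) V &
        forall V, C V -> open V /\
          exists2 q : 'rV[R]_n -> X, plot V q &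
            forall x, V x -> p x = F (q x)].

Definition prod_space (R : realType) (X Y : diffspace R) : diffspace R.
Proof.
apply: (@DiffSpace R (X * Y)%type
  (fun n U p => plot U (fst \o p) /\ plot U (snd \o p))).
- by move=> n U p [/plot_open].
- move=> n U p q pq [p1 p2]; split.
  + by apply: plot_ext p1 => x Ux /=; rewrite pq.
  + by apply: plot_ext p2 => x Ux /=; rewrite pq.
- by move=> n U [a b] oU; split; exact: plot_cst.
- by move=> n C p Cp; split; apply: plot_local => V /Cp[oV []].
- move=> n m U p V f [p1 p2] oV sf fVU; split.
  + exact: (plot_comp p1).
  + exact: (plot_comp p2).
Defined.

Definition sub_space (R : realType) (X : diffspace R) (P : X -> Prop) :
  diffspace R.
Proof.
apply: (@DiffSpace R {x : X | P x} (fun n U p => plot U (@sval X P \o p))).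
- by move=> n U p /plot_open.
- by move=> n U p q pq; apply: plot_ext => x Ux /=; rewrite pq.
- by move=> n U a oU; exact: plot_cst.
- by move=> n C p Cp; apply: plot_local.
- by move=> n m U p V f pU oV sf fVU; exact: (plot_comp pU).
Defined.

Definition fibprod (R : realType) (X Y Z : diffspace R) (f : X -> Z)
    (g : Y -> Z) : diffspace R :=
  sub_space (fun z : prod_space X Y => f z.1 = g z.2).

Definition fpair (R : realType) (X Y Z : diffspace R) (f : X -> Z)
    (g : Y -> Z) (x : X) (y : Y) (e : f x = g y) : fibprod f g :=
  exist (fun z : X * Y => f z.1 = g z.2) (x, y) e.

Definition ffst (R : realType) (X Y Z : diffspace R) (f : X -> Z) (g : Y -> Z)
  (z : fibprod f g) : X := (sval z).1.

Definition fsnd (R : realType) (X Y Z : diffspace R) (f : X -> Z) (g : Y -> Z)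
  (z : fibprod f g) : Y := (sval z).2.

(* A bijection between a subset of [X] and an open subset of R^dim, given
   together with its inverse. *)
Record chart (R : realType) (X : Type) := Chart {
  chart_dim : nat;
  chart_dom : set X;
  chart_img : set 'rV[R]_chart_dim;
  chart_map :> X -> 'rV[R]_chart_dim;
  chart_inv : 'rV[R]_chart_dim -> X;
  chart_open : open chart_img;
  chart_mapP : forall x, chart_dom x -> chart_img (chart_map x);
  chart_invP : forall v, chart_img v -> chart_dom (chart_inv v);
  chart_mapK : forall x, chart_dom x -> chart_inv (chart_map x) = x;
  chart_invK : forall v, chart_img v -> chart_map (chart_inv v) = v
}.
Arguments chart_img {R X} c _.
Arguments chart_inv {R X} c v.

Notation atlas R X := (set (chart R X)).

(* Atlases on a bare set, the topology being the one induced by the charts.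
   Different connected components may have different dimensions. *)
Definition smooth_atlas (R : realType) (X : Type) (A : atlas R X) : Prop :=
  (forall x, exists2 c, A c & chart_dom c x) /\
  (forall c d, A c -> A d ->
    let W := chart_img c `&` chart_inv c @^-1` chart_dom d in
    open W /\ smooth_on W (d \o chart_inv c)).

Definition atlas_space (R : realType) (X : Type) (A : atlas R X) : Type := X.

HB.instance Definition _ (R : realType) (X : Type) (A : atlas R X) :=
  gen_eqMixin (atlas_space A).
HB.instance Definition _ (R : realType) (X : Type) (A : atlas R X) :=
  gen_choiceMixin (atlas_space A).

Definition atlas_open (R : realType) (X : Type) (A : atlas R X)
    (O : set (atlas_space A)) : Prop :=
  forall c, A c -> open (chart_img c `&` chart_inv c @^-1` O).

Lemma atlas_openT (R : realType) (X : Type) (A : atlas R X) :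
  @atlas_open R X A setT.
Proof. by move=> c _; rewrite preimage_setT setIT; exact: chart_open. Qed.

Lemma atlas_openI (R : realType) (X : Type) (A : atlas R X) :
  setI_closed (@atlas_open R X A).
Proof.
move=> O O' oO oO' c Ac; rewrite preimage_setI setIIr.
by apply: openI; [exact: oO | exact: oO'].
Qed.

Lemma atlas_open_bigU (R : realType) (X : Type) (A : atlas R X) (I : Type)
    (f : I -> set (atlas_space A)) :
  (forall i, atlas_open (f i)) -> atlas_open (\bigcup_i f i).
Proof.
move=> of_ c Ac; rewrite preimage_bigcup setI_bigcupr.
by apply: bigcup_open => i _; exact: of_.
Qed.

HB.instance Definition _ (R : realType) (X : Type) (A : atlas R X) :=
  isOpenTopological.Build (atlas_space A) (@atlas_openT R X A)
    (@atlas_openI R X A) (@atlas_open_bigU R X A).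

Definition smooth_param (R : realType) (X : Type) (A : atlas R X) (n : nat)
    (U : set 'rV[R]_n) (p : 'rV[R]_n -> X) : Prop :=
  [/\ open U,
      forall x, U x -> {for x, continuous (p : 'rV[R]_n -> atlas_space A)} &
      forall c, A c -> smooth_on (U `&` p @^-1` chart_dom c) (c \o p)].

(* The atlas [A] is a smooth manifold structure inducing the diffeology of
   [X]. *)
Definition manifold_structure (R : realType) (X : diffspace R)
    (A : atlas R X) : Prop :=
  smooth_atlas A /\
  forall n (U : set 'rV[R]_n) (p : 'rV[R]_n -> X),
    plot U p <-> smooth_param A U p.

Definition coord_rep (R : realType) (X Y : Type) (c : chart R X)
    (d : chart R Y) (f : X -> Y) : 'rV[R]_(chart_dim c) -> 'rV[R]_(chart_dim d) :=
  d \o f \o chart_inv c.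
Arguments coord_rep {R X Y} c d f _.

Definition smooth_map (R : realType) (X Y : Type) (A : atlas R X)
    (B : atlas R Y) (f : X -> Y) : Prop :=
  continuous (f : atlas_space A -> atlas_space B) /\
  forall c d, A c -> B d ->
    smooth_on (chart_img c `&` (f \o chart_inv c) @^-1` chart_dom d)
      (coord_rep c d f).

Definition manifold_diffeo (R : realType) (X Y : Type) (A : atlas R X)
    (B : atlas R Y) (f : X -> Y) : Prop :=
  smooth_map A B f /\
  exists2 f' : Y -> X, smooth_map B A f' & cancel f f' /\ cancel f' f.

Definition submersion (R : realType) (X Y : Type) (A : atlas R X)
    (B : atlas R Y) (f : X -> Y) : Prop :=
  smooth_map A B f /\
  forall c d x, A c -> B d -> chart_dom c x -> chart_dom d (f x) ->
    forall w, exists v, 'd (coord_rep c d f) (c x) v = w.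

Definition immersion (R : realType) (X Y : Type) (A : atlas R X)
    (B : atlas R Y) (f : X -> Y) : Prop :=
  smooth_map A B f /\
  forall c d x, A c -> B d -> chart_dom c x -> chart_dom d (f x) ->
    injective ('d (coord_rep c d f) (c x)).

Definition prod_chart (R : realType) (X Y : Type) (c : chart R X)
  (d : chart R Y) : chart R (X * Y).
Proof.
apply: (@Chart R (X * Y)%type (chart_dim c + chart_dim d)
  (chart_dom c `*` chart_dom d)
  (lsubmx @^-1` chart_img c `&` rsubmx @^-1` chart_img d)
  (fun z => row_mx (c z.1) (d z.2))
  (fun v => (chart_inv c (lsubmx v), chart_inv d (rsubmx v)))).
- apply: openI.
  + apply: open_comp; last exact: chart_open.
    by move=> v _; exact: continuous_lsubmx.
  + apply: open_comp; last exact: chart_open.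
    by move=> v _; exact: continuous_rsubmx.
- move=> [x y] [/= cx dy]; rewrite /preimage /= row_mxKl row_mxKr.
  by split; exact: chart_mapP.
- by move=> v [cv dv]; split; exact: chart_invP.
- by move=> [x y] [/= cx dy]; rewrite row_mxKl row_mxKr !chart_mapK.
- by move=> v [cv dv] /=; rewrite !chart_invK// hsubmxK.
Defined.

Definition prod_atlas (R : realType) (X Y : Type) (A : atlas R X)
    (B : atlas R Y) : atlas R (X * Y) :=
  [set e | exists c d, [/\ A c, B d & e = prod_chart c d]].

(* [B] is the (unique up to equivalence) structure of an embedded submanifold
   on the subset [P] of a manifold with atlas [A]. *)
Definition embedded_structure (R : realType) (X : Type) (A : atlas R X)
    (P : X -> Prop) (B : atlas R {x : X | P x}) : Prop :=
  [/\ smooth_atlas B, immersion B A (@sval X P) &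
    forall O : set (atlas_space B), open O <->
      exists2 O' : set (atlas_space A), open O' & O = @sval X P @^-1` O'].

Definition fibprod_structure (R : realType) (X Y Z : diffspace R) (f : X -> Z)
    (g : Y -> Z) (A : atlas R X) (B : atlas R Y)
    (C : atlas R (fibprod f g)) : Prop :=
  @embedded_structure R (X * Y) (prod_atlas A B)
    (fun z => f z.1 = g z.2) C.

Record diff_groupoid (R : realType) := DiffGroupoid {
  obj : diffspace R;
  arr : diffspace R;
  src : arr -> obj;
  tgt : arr -> obj;
  unt : obj -> arr;
  mul : fibprod src tgt -> arr;
  inv : arr -> arr;
  src_unt : forall x, src (unt x) = x;
  tgt_unt : forall x, tgt (unt x) = x;
  src_mul : forall g h (e : src g = tgt h), src (mul (fpair e)) = src h;
  tgt_mul : forall g h (e : src g = tgt h), tgt (mul (fpair e)) = tgt g;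
  mulA : forall g h k (gh : src g = tgt h) (hk : src h = tgt k)
      (gh_k : src (mul (fpair gh)) = tgt k)
      (g_hk : src g = tgt (mul (fpair hk))),
    mul (fpair gh_k) = mul (fpair g_hk);
  mul_unt_l : forall g (e : src (unt (tgt g)) = tgt g), mul (fpair e) = g;
  mul_unt_r : forall g (e : src g = tgt (unt (src g))), mul (fpair e) = g;
  src_inv : forall g, src (inv g) = tgt g;
  tgt_inv : forall g, tgt (inv g) = src g;
  mul_inv_l : forall g (e : src (inv g) = tgt g),
    mul (fpair e) = unt (src g);
  mul_inv_r : forall g (e : src g = tgt (inv g)),
    mul (fpair e) = unt (tgt g);
  src_smooth : diff_smooth src;
  tgt_smooth : diff_smooth tgt;
  unt_smooth : diff_smooth unt;
  mul_smooth : diff_smooth mul;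
  inv_smooth : diff_smooth inv
}.

Record lie_groupoid (R : realType) := LieGroupoid {
  lie_diff :> diff_groupoid R;
  obj_atlas : atlas R (obj lie_diff);
  arr_atlas : atlas R (arr lie_diff);
  obj_manifold : manifold_structure obj_atlas;
  obj_hausdorff : hausdorff_space (atlas_space obj_atlas);
  obj_second_countable : @second_countable (atlas_space obj_atlas);
  arr_manifold : manifold_structure arr_atlas;
  src_submersion : submersion arr_atlas obj_atlas (@src R lie_diff);
  tgt_submersion : submersion arr_atlas obj_atlas (@tgt R lie_diff)
}.
Arguments obj_atlas {R} l _.
Arguments arr_atlas {R} l _.

Record bibundle (R : realType) (G H : diff_groupoid R) := Bibundle {
  bispace :> diffspace R;
  lanchor : bispace -> obj G;
  ranchor : bispace -> obj H;
  lact : fibprod (@src R G) lanchor -> bispace;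
  ract : fibprod ranchor (@tgt R H) -> bispace;
  lanchor_smooth : diff_smooth lanchor;
  ranchor_smooth : diff_smooth ranchor;
  lact_smooth : diff_smooth lact;
  ract_smooth : diff_smooth ract;
  lanchor_lact : forall g x (e : src g = lanchor x),
    lanchor (lact (fpair e)) = tgt g;
  lactA : forall g' g x (g'g : src g' = tgt g) (gx : src g = lanchor x)
      (g'_gx : src g' = lanchor (lact (fpair gx)))
      (g'g_x : src (mul (fpair g'g)) = lanchor x),
    lact (fpair g'_gx) = lact (fpair g'g_x);
  lact_unt : forall x (e : src (unt (lanchor x)) = lanchor x),
    lact (fpair e) = x;
  ranchor_ract : forall x h (e : ranchor x = tgt h),
    ranchor (ract (fpair e)) = src h;
  ractA : forall x h h' (xh : ranchor x = tgt h) (hh' : src h = tgt h')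
      (xh_h' : ranchor (ract (fpair xh)) = tgt h')
      (x_hh' : ranchor x = tgt (mul (fpair hh'))),
    ract (fpair xh_h') = ract (fpair x_hh');
  ract_unt : forall x (e : ranchor x = tgt (unt (ranchor x))),
    ract (fpair e) = x;
  lanchor_ract : forall z : fibprod ranchor (@tgt R H),
    lanchor (ract z) = lanchor (ffst z);
  ranchor_lact : forall z : fibprod (@src R G) lanchor,
    ranchor (lact z) = ranchor (fsnd z);
  lract : forall g x h (gx : src g = lanchor x) (xh : ranchor x = tgt h)
      (gx_h : ranchor (lact (fpair gx)) = tgt h)
      (g_xh : src g = lanchor (ract (fpair xh))),
    ract (fpair gx_h) = lact (fpair g_xh)
}.
Arguments lanchor {R G H} b _.
Arguments ranchor {R G H} b _.
Arguments lact {R G H} b _.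
Arguments ract {R G H} b _.

(* (x, h) |-> (x, xh) *)
Definition rshear (R : realType) (G H : diff_groupoid R) (X : bibundle G H)
    (z : fibprod (ranchor X) (@tgt R H)) :
    fibprod (lanchor X) (lanchor X) :=
  fpair (esym (lanchor_ract z)).

(* (g, x) |-> (gx, x) *)
Definition lshear (R : realType) (G H : diff_groupoid R) (X : bibundle G H)
    (z : fibprod (@src R G) (lanchor X)) :
    fibprod (ranchor X) (ranchor X) :=
  fpair (ranchor_lact z).

Definition right_principal (R : realType) (G H : diff_groupoid R)
    (X : bibundle G H) : Prop :=
  subduction (lanchor X) /\ diffeomorphism (@rshear R G H X).

Definition left_principal (R : realType) (G H : diff_groupoid R)
    (X : bibundle G H) : Prop :=
  subduction (ranchor X) /\ diffeomorphism (@lshear R G H X).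

Definition biprincipal (R : realType) (G H : diff_groupoid R)
    (X : bibundle G H) : Prop :=
  left_principal X /\ right_principal X.

Definition surjective_submersion (R : realType) (X Y : Type) (A : atlas R X)
    (B : atlas R Y) (f : X -> Y) : Prop :=
  submersion A B f /\ forall y, exists x, f x = y.

(* The fibre products are regarded as embedded submanifolds of the products. *)
Definition lie_biprincipal (R : realType) (G H : lie_groupoid R)
    (X : bibundle G H) : Prop :=
  exists2 A : atlas R X, manifold_structure A &
    [/\ surjective_submersion A (obj_atlas G) (lanchor X),
        surjective_submersion A (obj_atlas H) (ranchor X) &
    exists (AL : atlas R (fibprod (@src R G) (lanchor X)))
           (AR : atlas R (fibprod (ranchor X) (@tgt R H)))
           (BL : atlas R (fibprod (ranchor X) (ranchor X)))
           (BR : atlas R (fibprod (lanchor X) (lanchor X))),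
      [/\ [/\ fibprod_structure (arr_atlas G) A AL,
              fibprod_structure A (arr_atlas H) AR,
              fibprod_structure A A BL &
              fibprod_structure A A BR],
          smooth_map AL A (lact X),
          smooth_map AR A (ract X),
          manifold_diffeo AR BR (@rshear R G H X) &
          manifold_diffeo AL BL (@lshear R G H X)]].

(* Main.v *)
Require Import Defs.
From HB Require Import structures.
From mathcomp Require Import all_boot all_order all_algebra.
From mathcomp Require Import all_classical all_reals all_analysis.
From mathcomp Require Import ring lra.

(** The anchor l : X -> G_0 is a subduction, so near each point of G_0 it has a
    smooth section sigma.  By right principality every x over the domain of
    sigma is sigma(l x) h for exactly one arrow h of H, and h depends smoothly
    on x.  Hence X is, locally, the pullback of the target map
    t : H_1 -> H_0 along r sigma.  Since t is a submersion of manifolds, it is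
    locally a projection Z x R^k -> Z, and so is its pullback: this gives
    charts of X ([pullback_chart]).

    A smooth map between manifolds is a submersion as soon as it has a smooth
    local section through each point ([submersion_of_sections]), because the
    differential of the section is a right inverse of its differential.  A
    local section of l through x is y |-> sigma(y) tau(r(sigma(y))), where tau
    is a local section of t through the arrow h with sigma(l x) h = x; the
    section of r is obtained in the same way from left principality and the
    source map of G.

    All four fibre products of the conclusion are pullbacks along a submersion.
    They get charts by the same [pullback_chart], and they are embedded because
    sliding along the fibres of the submersion gives a smooth local retraction
    of the ambient product onto them ([fibprod_submersion],
    [embedded_of_retraction]).  Smoothness of the actions and of the shear maps
    then holds by hypothesis, diffeological and classical smoothness being the
    same for maps between manifolds ([diff_smooth_map]).

    Everything is thus done with plots, through the notion [gchart] of a chart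
    adapted to a diffeology: a bijection between a D-open set and an open set
    of R^n, smooth both ways.  A diffeological space covered by such charts is
    a manifold, and the charts of a manifold are of this kind
    ([manifold_of_gcharts], [gchart_of_manifold]).

    The analytic input is the local form of submersions
    ([submersion_straighten]), which rests on the inverse function theorem
    ([local_inverse]) for maps all of whose iterated partial derivatives are
    continuous.  Both are derived from a single estimate,
    [partial_increment], that bounds the increments of a function in terms of
    its partial derivatives. *)

Set Implicit Arguments.
Unset Strict Implicit.
Unset Printing Implicit Defensive.

Import Order.TTheory GRing.Theory Num.Theory.
Import numFieldNormedType.Exports.

Local Open Scope classical_set_scope.
Local Open Scope ring_scope.

(** * Differentiability from continuous partial derivatives *)

Section C1.
Variable R : realType.

Lemma norm_rV_le n (x : 'rV[R]_n) (c : R) :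
  0 <= c -> (forall i, `|x 0 i| <= c) -> `|x| <= c.
Proof.
move=> c0 xc; rewrite [leLHS]/Num.Def.normr/= mx_normrE.
by apply: bigmax_le => // -[i j] _ /=; rewrite ord1.
Qed.

Lemma norm_coord_le n (x : 'rV[R]_n) i : `|x 0 i| <= `|x|.
Proof.
rewrite [leRHS]/Num.Def.normr/= mx_normrE.
exact: (le_bigmax _ (fun ij : 'I_1 * 'I_n => `|x ij.1 ij.2|) (0, i)).
Qed.

Lemma is_derive_line n (f : 'rV[R]_n -> R) (x v : 'rV[R]_n) (t : R) :
  derivable f (t *: v + x) v ->
  is_derive t 1 (fun s : R => f (s *: v + x)) ('D_v f (t *: v + x)).
Proof.
move=> df.
have E : (fun h : R => h^-1 *: (((fun s : R => f (s *: v + x)) \o shift t) (h *: 1)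
            - f (t *: v + x))) =
         (fun h : R => h^-1 *: ((f \o shift (t *: v + x)) (h *: v) - f (t *: v + x))).
  by apply/funext => h /=; rewrite scalerDl -addrA [h *: 1]mulr1.
by split; rewrite /derivable /derive E.
Qed.

(** The mean value theorem along the segment from [x] to [h *: v + x], whose points
    are the [t *: v + x] with [t] between [0] and [h]; the last two conditions on
    [t] express this betweenness without a case distinction on the sign of [h]. *)
Lemma line_increment n (f : 'rV[R]_n -> R) (x v : 'rV[R]_n) (h a eps : R) :
  (forall t, `|t| <= `|h| -> 0 <= t * h ->
    derivable f (t *: v + x) v /\ `|'D_v f (t *: v + x) - a| <= eps) ->
  `|f (h *: v + x) - f x - a * h| <= eps * `|h|.
Proof.
move=> H; pose g (s : R) := f (s *: v + x).
have g0 : f x = g 0 by rewrite /g scale0r add0r.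
have key (b c : R) : b <= c -> (forall t, b <= t <= c -> `|t| <= `|h| /\ 0 <= t * h) ->
    `|g c - g b - a * (c - b)| <= eps * (c - b).
  move=> bc tbc.
  have dg (t : R) : b <= t <= c -> is_derive t 1 g ('D_v f (t *: v + x)).
    by move=> /tbc[t1 t2]; apply: is_derive_line; have [] := H _ t1 t2.
  have dg' t : t \in `]b, c[%R -> is_derive t 1 g ('D_v f (t *: v + x)).
    by rewrite in_itv/= => /andP[/ltW bt /ltW tc]; apply: dg; rewrite bt.
  have gc : {within `[b, c], continuous g}.
    apply: derivable_within_continuous => t; rewrite in_itv/= => tt.
    by have [] := dg t tt.
  have [t] := MVT_segment bc dg' gc.
  rewrite in_itv/= => /tbc[t1 t2] ->; rewrite -mulrBl normrM.
  rewrite (ger0_norm (x := c - b)) ?subr_ge0// ler_wpM2r ?subr_ge0//.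
  by have [] := H _ t1 t2.
rewrite g0 -/(g h); have [h0|h0] := leP 0 h.
  have := key 0 h h0; rewrite subr0 (ger0_norm h0); apply => t /andP[t0 th].
  by rewrite !ger0_norm// mulr_ge0.
have := key h 0 (ltW h0); rewrite sub0r (ltr0_norm h0) => K.
rewrite -normrN (_ : - (g h - g 0 - a * h) = g 0 - g h - a * - h); last by ring.
have h0' := ltW h0; apply: K => t /andP[th t0]; rewrite !ler0_norm//.
by rewrite lerN2 th mulr_le0.
Qed.

(** Applied in each coordinate, this keeps a path along the coordinate directions
    inside a ball of the sup norm. *)
Lemma between_norm (u v t : R) : `|t| <= `|v - u| -> 0 <= t * (v - u) ->
  (`|t + u| <= `|u|) || (`|t + u| <= `|v|).
Proof.
wlog uv : u v t / u <= v => [W|].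
  have [|/ltW vu] := leP u v; first exact: W.
  move=> t1 t2; rewrite -(normrN (t + u)) -(normrN u) -(normrN v) opprD.
  apply: W; first by rewrite lerN2.
    by rewrite normrN -opprD normrN.
  by rewrite -opprD mulrNN.
rewrite (ger0_norm (x := v - u)) ?subr_ge0// => t1 t2.
have [t0|t0] := leP 0 t.
  rewrite ger0_norm// in t1.
  have [tu|tu] := leP 0 (t + u); apply/orP; [right|left].
    by rewrite (ger0_norm tu) (le_trans _ (ler_norm v))//; lra.
  by rewrite (ltr0_norm tu) (ltr0_norm (x := u))//; lra.
have : v - u <= 0 by rewrite leNgt; apply/negP => uv'; move: t2; nra.
by rewrite ltr0_norm// in t1; lra.
Qed.

(** The vertices of the path that goes from [x] to [y] by changing one coordinate at
    a time. *)
Definition hybrid n (x y : 'rV[R]_n) (k : nat) : 'rV[R]_n :=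
  \row_j (if (j < k)%N then y 0 j else x 0 j).

(** Going from [x] to [y] along the coordinate directions stays in the ball, as the
    norm is the sup norm, and each of the [n] steps is controlled by the mean value
    theorem.  With [eps] tending to [0] this shows that continuous partial
    derivatives imply differentiability; with [eps] fixed it gives the contraction
    estimate of the inverse function theorem. *)
Lemma partial_increment n (f : 'rV[R]_n -> R) (x0 a : 'rV[R]_n) (r eps : R) :
  (forall x, `|x - x0| < r -> forall i, derivable f x (delta_mx 0 i) /\
     `|'D_(delta_mx 0 i) f x - a 0 i| <= eps) ->
  forall x y, `|x - x0| < r -> `|y - x0| < r ->
    `|f y - f x - \sum_i a 0 i * (y 0 i - x 0 i)| <= n%:R * eps * `|y - x|.
Proof.
move=> H x y xr yr.
have r0 : 0 < r by rewrite (le_lt_trans _ xr).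
have hstep (i : 'I_n) : hybrid x y i.+1 =
    (y 0 i - x 0 i) *: delta_mx 0 i + hybrid x y i.
  apply/rowP => j; rewrite !mxE eqxx/= ltnS; have [->|ji] := eqVneq j i.
    by rewrite leqnn ltnn mulr1 subrK.
  by rewrite mulr0 add0r ltn_neqAle ji.
have hin (i : 'I_n) t : `|t| <= `|y 0 i - x 0 i| -> 0 <= t * (y 0 i - x 0 i) ->
    `|t *: delta_mx 0 i + hybrid x y i - x0| < r.
  move=> t1 t2.
  apply: (@le_lt_trans _ _ (Num.max `|x - x0| `|y - x0|)); last by rewrite gt_max xr.
  apply: norm_rV_le; first by rewrite le_max normr_ge0.
  move=> j; rewrite !mxE eqxx/=.
  have xj := norm_coord_le (x - x0) j; have yj := norm_coord_le (y - x0) j.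
  rewrite !mxE in xj yj; rewrite le_max; have [ji|ji] := eqVneq j i; last first.
    by rewrite mulr0 add0r; case: ifP => _; rewrite ?xj ?yj ?orbT.
  rewrite ji ltnn mulr1 -addrA in xj yj *.
  have := @between_norm (x 0 i - x0 0 i) (y 0 i - x0 0 i) t.
  have -> : y 0 i - x0 0 i - (x 0 i - x0 0 i) = y 0 i - x 0 i by ring.
  move=> /(_ t1 t2) /orP[] h; apply/orP; [left|right].
    exact: le_trans h xj.
  exact: le_trans h yj.
have -> : f y - f x = \sum_(i < n) (f (hybrid x y i.+1) - f (hybrid x y i)).
  rewrite -(big_mkord xpredT (fun i => f (hybrid x y i.+1) - f (hybrid x y i))).
  rewrite telescope_sumr//; congr (f _ - f _); apply/rowP => j; rewrite mxE ?ltn0//.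
  by rewrite ltn_ord.
rewrite -sumrB (le_trans (ler_norm_sum _ _ _))//.
apply: (@le_trans _ _ (\sum_(i < n) eps * `|y - x|)); last first.
  by rewrite sumr_const card_ord -mulrA mulr_natl.
apply: ler_sum => i _; rewrite hstep.
have eps0 : 0 <= eps by have [_] := H x xr i; apply: le_trans.
apply: (@le_trans _ _ (eps * `|y 0 i - x 0 i|)).
  by apply: line_increment => t t1 t2; apply: H; exact: hin.
rewrite ler_wpM2l//; have := norm_coord_le (y - x) i; by rewrite !mxE.
Qed.

Lemma near_dist (V : normedModType R) (x : V) (P : V -> Prop) :
  (\forall y \near x, P y) <-> exists2 r, 0 < r & forall y, `|y - x| < r -> P y.
Proof.
split=> [/nbhs_normP[r /= r0 H]|[r r0 H]].
  by exists r => // y yr; apply: H; rewrite /= distrC.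
by apply/nbhs_normP; exists r => // y /= yr; apply: H; rewrite distrC.
Qed.

(** Fréchet differentiability in epsilon form, together with its converse
    [diff_estimate] below, replaces the manipulation of Landau symbols. *)
Lemma diff_of_estimate (V W : normedModType R) (f : V -> W) (x : V) (L : {linear V -> W}) :
  continuous L ->
  (forall e, 0 < e -> \forall y \near x, `|f y - f x - L (y - x)| <= e * `|y - x|) ->
  differentiable f x /\ 'd f x = L :> (V -> W).
Proof.
move=> cL H.
have E : f \o shift x = cst (f x) + L +o_ 0 id.
  apply/eqaddoP => e /H /near_dist[r r0 h].
  apply/near_dist; exists r => // y; rewrite subr0 => yr.
  by have := h (y + x); rewrite addrK => /(_ yr) /=; rewrite -addrA -opprD.
have dE := diff_unique cL E; split => //.
by apply/diff_locallyP; rewrite dE.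
Qed.

Definition rowdot n (a : 'rV[R]_n) (v : 'rV[R]_n) : R := \sum_i a 0 i * v 0 i.

Lemma rowdot_linear n a : linear (@rowdot n a).
Proof.
move=> k u v; rewrite /rowdot scaler_sumr -big_split; apply: eq_bigr => i _ /=.
by rewrite !mxE /GRing.scale/=; ring.
Qed.

HB.instance Definition _ n (a : 'rV[R]_n) :=
  GRing.isLinear.Build R 'rV[R]_n R _ (@rowdot n a) (@rowdot_linear n a).

Lemma rowdot_continuous n (a : 'rV[R]_n) : continuous (rowdot a).
Proof.
move=> x; apply: differentiable_continuous.
have -> : rowdot a = \sum_(i < n) ((a 0 i) *: (fun v : 'rV[R]_n => v 0 i)).
  by apply/funext => v; rewrite fct_sumE.
by apply: differentiable_sum => i; apply: differentiableZ; exact: differentiable_coord.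
Qed.

Lemma C1_differentiable n (f : 'rV[R]_n -> R) (x0 : 'rV[R]_n) :
  (\forall x \near x0, forall i, derivable f x (delta_mx 0 i)) ->
  (forall i, {for x0, continuous ('D_(delta_mx 0 i) f)}) ->
  differentiable f x0.
Proof.
move=> df cf; pose a : 'rV[R]_n := \row_i 'D_(delta_mx 0 i) f x0.
suff [] : differentiable f x0 /\ 'd f x0 = rowdot a :> (_ -> _) by [].
apply: (@diff_of_estimate _ _ f x0 (rowdot a)) => [|e e0]; first exact: rowdot_continuous.
pose eps := e / n.+1%:R.
have eps0 : 0 < eps by rewrite divr_gt0.
have : \forall x \near x0, forall i, derivable f x (delta_mx 0 i) /\
     `|'D_(delta_mx 0 i) f x - a 0 i| <= eps.
  have ca : \forall x \near x0, forall i : 'I_n,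
      `|'D_(delta_mx 0 i) f x - a 0 i| <= eps.
    apply: (@filter_forall _ _ (fun i x => `|'D_(delta_mx 0 i) f x - a 0 i| <= eps)
      (nbhs x0) _) => i; have /cvgrPdist_le/(_ _ eps0) := cf i.
    by apply: filterS => x; rewrite mxE distrC.
  by apply: filterS2 df ca => x dfx cax i.
move=> /near_dist[r r0 H]; apply/near_dist; exists r => // y yr.
have := partial_increment H (x := x0) _ yr; rewrite subrr normr0 => /(_ r0).
rewrite /=; have -> : rowdot a (y - x0) = \sum_i a 0 i * (y 0 i - x0 0 i).
  by apply: eq_bigr => i _; rewrite !mxE.
move=> hle; apply: (le_trans hle); rewrite ler_wpM2r//.
rewrite /eps mulrCA ler_piMr ?(ltW e0)// ler_pdivrMr// mul1r ler_nat//.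
Qed.
End C1.

(** * Calculus of smooth functions *)

Section CkCalculus.
Variable R : realType.
Local Notation "''e_' i" := (delta_mx 0 i) (at level 8, i at level 2, format "''e_' i").

(** Being of class C^k, for scalar functions on an open set and phrased with partial
    derivatives only, so that all orders together match [smooth_on] coordinatewise
    ([smooth_onP]). *)
Fixpoint Ck n (k : nat) (U : set 'rV[R]_n) (f : 'rV[R]_n -> R) : Prop :=
  (forall x, U x -> {for x, continuous f}) /\
  (if k is k'.+1 then forall i, (forall x, U x -> derivable f x 'e_i) /\
     Ck k' U ('D_'e_i f) else True).

Lemma near_of_open (V : normedModType R) (U : set V) (x : V) (P : V -> Prop) :
  open U -> U x -> (forall y, U y -> P y) -> \forall y \near x, P y.
Proof. by move=> oU Ux H; apply: filterS (open_nbhs_nbhs (conj oU Ux)). Qed.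

Lemma Ck_cont n k (U : set 'rV[R]_n) f x : Ck k U f -> U x -> {for x, continuous f}.
Proof. by case: k => [|k] [+ _]; apply. Qed.

Lemma continuous_eq_on (V : normedModType R) (T : topologicalType) (U : set V)
    (f g : V -> T) x :
  open U -> (forall x, U x -> f x = g x) -> U x ->
  {for x, continuous f} -> {for x, continuous g}.
Proof.
move=> oU fg Ux cf; rewrite /prop_for/continuous_at -(fg _ Ux).
apply: cvg_trans cf; apply: near_eq_cvg.
exact: (near_of_open (P := fun y => f y = g y) oU Ux fg).
Qed.

Lemma Ck_eq n k (U : set 'rV[R]_n) (f g : 'rV[R]_n -> R) :
  open U -> (forall x, U x -> f x = g x) -> Ck k U f -> Ck k U g.
Proof.
move=> oU; elim: k f g => [|k IH] f g fg; move=> [cf df].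
  split=> // x Ux; by apply: (continuous_eq_on oU fg Ux); exact: cf.
split=> [x Ux|i]; first by apply: (continuous_eq_on oU fg Ux); exact: cf.
have [d1 d2] := df i; split=> [x Ux|].
  by apply: near_eq_derivable (d1 x Ux); exact: near_of_open oU Ux fg.
apply: IH d2 => x Ux; apply: near_eq_derive; exact: near_of_open oU Ux fg.
Qed.

Lemma Ck_mono n k (U : set 'rV[R]_n) f : Ck k.+1 U f -> Ck k U f.
Proof.
elim: k f => [|k IH] f [cf df]; first by split.
by split=> // i; have [d1 /IH d2] := df i.
Qed.

Lemma Ck_diff n k (U : set 'rV[R]_n) f x : open U -> Ck k.+1 U f -> U x ->
  differentiable f x.
Proof.
move=> oU [cf df] Ux; apply: C1_differentiable.
  by apply: near_of_open oU Ux _ => y Uy i; have [d1 _] := df i; exact: d1.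
by move=> i; have [_ d2] := df i; apply: Ck_cont d2 Ux.
Qed.

(** The way to raise the order by one: the next derivative need only be known on
    [U], and in any closed form that is already of class C^k. *)
Lemma Ck_succ n k (U : set 'rV[R]_n) (f : 'rV[R]_n -> R) (g : 'I_n -> 'rV[R]_n -> R) :
  open U -> (forall x, U x -> differentiable f x) ->
  (forall i, Ck k U (g i)) -> (forall i x, U x -> 'D_'e_i f x = g i x) ->
  Ck k.+1 U f.
Proof.
move=> oU df dg dfg; split=> [x Ux|i].
  exact: differentiable_continuous (df x Ux).
split=> [x Ux|]; first exact: diff_derivable (df x Ux).
by apply: Ck_eq (dg i) => // x Ux; rewrite dfg.
Qed.

Lemma Ck_cst n k (U : set 'rV[R]_n) (c : R) : open U -> Ck k U (fun=> c).
Proof.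
move=> oU; elim: k c => [|k IH] c.
  by split=> // x _; exact: cst_continuous.
apply: (Ck_succ (g := fun i _ => 0)) => [//|x _|i|i x _]; first 1 last.
- exact: IH.
- exact: derive_cst.
- exact: differentiable_cst.
Qed.

Lemma CkD n k (U : set 'rV[R]_n) f g : open U -> Ck k U f -> Ck k U g ->
  Ck k U (fun x => f x + g x).
Proof.
move=> oU; elim: k f g => [|k IH] f g hf hg.
  split=> // x Ux; apply: continuousD; [exact: hf.1|exact: hg.1].
apply: (Ck_succ (g := fun i x => 'D_'e_i f x + 'D_'e_i g x)) => [//|x Ux|i|i x Ux].
- by apply: differentiableD; [exact: Ck_diff hf Ux|exact: Ck_diff hg Ux].
- by apply: IH; [have [_] := hf.2 i|have [_] := hg.2 i].
- have [d1 _] := hf.2 i; have [d2 _] := hg.2 i.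
  by rewrite -[LHS]/('D_'e_i (f + g) x) deriveD; [|exact: d1|exact: d2].
Qed.

(** In the inductive step, Leibniz' rule expresses the derivative of a product by
    products of functions of class C^k; [CkV] and [Ck_comp] follow the same scheme
    with the derivative of the inverse and the chain rule. *)
Lemma CkM n k (U : set 'rV[R]_n) f g : open U -> Ck k U f -> Ck k U g ->
  Ck k U (fun x => f x * g x).
Proof.
move=> oU; elim: k f g => [|k IH] f g hf hg.
  by split=> // x Ux; apply: continuousM; [exact: hf.1|exact: hg.1].
apply: (Ck_succ (g := fun i x => f x * 'D_'e_i g x + g x * 'D_'e_i f x)) => [//|x Ux|i|i x Ux].
- by apply: differentiableM; [exact: Ck_diff hf Ux|exact: Ck_diff hg Ux].
- by apply: CkD => //; (apply: IH; first exact: Ck_mono);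
    [have [_] := hg.2 i|have [_] := hf.2 i].
- have [d1 _] := hf.2 i; have [d2 _] := hg.2 i.
  by rewrite -[LHS]/('D_'e_i (f * g) x) deriveM; [|exact: d1|exact: d2].
Qed.

Lemma CkV n k (U : set 'rV[R]_n) f : open U -> (forall x, U x -> f x != 0) ->
  Ck k U f -> Ck k U (fun x => (f x)^-1).
Proof.
move=> oU f0; elim: k => [|k IH] hf.
  by split=> // x Ux; apply: continuousV; [exact: f0|exact: hf.1].
have hV := IH (Ck_mono hf).
apply: (Ck_succ (g := fun i x => -1 * (((f x)^-1 * (f x)^-1) * 'D_'e_i f x))) => [//|x Ux|i|i x Ux].
- apply: differentiableV; [exact: Ck_diff hf Ux|exact: f0].
- apply: CkM => //; first exact: Ck_cst.
  by apply: CkM => //; [exact: CkM|have [_] := hf.2 i].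
- rewrite deriveV ?f0//; last by have [+ _] := hf.2 i; apply.
  by rewrite expr2 invfM scaleNr mulN1r.
Qed.

Lemma Ck_sum n k (U : set 'rV[R]_n) (I : Type) (s : seq I) (F : I -> 'rV[R]_n -> R) :
  open U -> (forall i, Ck k U (F i)) -> Ck k U (fun x => \sum_(i <- s) F i x).
Proof.
move=> oU hF; elim: s => [|i s IH].
  by apply: (Ck_eq (f := fun=> 0)) => // [x _|]; [rewrite big_nil|exact: Ck_cst].
apply: (Ck_eq (f := fun x => F i x + \sum_(j <- s) F j x)) => // [x _|].
  by rewrite big_cons.
exact: CkD.
Qed.

Lemma Ck_prod n k (U : set 'rV[R]_n) (I : Type) (s : seq I) (F : I -> 'rV[R]_n -> R) :
  open U -> (forall i, Ck k U (F i)) -> Ck k U (fun x => \prod_(i <- s) F i x).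
Proof.
move=> oU hF; elim: s => [|i s IH].
  by apply: (Ck_eq (f := fun=> 1)) => // [x _|]; [rewrite big_nil|exact: Ck_cst].
apply: (Ck_eq (f := fun x => F i x * \prod_(j <- s) F j x)) => // [x _|].
  by rewrite big_cons.
exact: CkM.
Qed.

Lemma Ck_coord n k (U : set 'rV[R]_n) (j : 'I_n) : open U -> Ck k U (fun x => x 0 j).
Proof.
move=> oU; case: k => [|k].
  by split=> // x _; exact: coord_continuous.
apply: (Ck_succ (g := fun i _ => ('e_i : 'rV[R]_n) 0 j)) => [//|x _|i|i x _].
- exact: differentiable_coord.
- exact: Ck_cst.
- have /(derive_mx (M := id)) : derivable (id : 'rV[R]_n -> _) x 'e_i by exact: derivable_id.
  by rewrite derive_id => /rowP/(_ j) ->; rewrite [RHS]mxE.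
Qed.

Lemma differentiable_rV n m (F : 'rV[R]_n -> 'rV[R]_m) x :
  (forall j, differentiable (fun y => F y 0 j) x) -> differentiable F x.
Proof.
move=> dF; have -> : F = \sum_(j < m) (fun y => F y 0 j *: ('e_j : 'rV[R]_m)).
  by apply/funext => y; rewrite fct_sumE -row_sum_delta.
by apply: differentiable_sum => j; apply: differentiableZl.
Qed.

Lemma continuous_rV (T : topologicalType) m (F : T -> 'rV[R]_m) x :
  (forall j, {for x, continuous (fun y => F y 0 j)}) -> {for x, continuous F}.
Proof.
move=> cF; apply/cvgrPdist_le => e e0.
have : \forall y \near x, forall j, `|F x 0 j - F y 0 j| <= e.
  apply: (@filter_forall _ _ (fun j y => `|F x 0 j - F y 0 j| <= e) (nbhs x) _) => j.
  by have /cvgrPdist_le/(_ _ e0) := cF j.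
by apply: filterS => y H; apply: norm_rV_le => [|j]; [exact: ltW|rewrite !mxE].
Qed.

Lemma derive_coord n m (F : 'rV[R]_n -> 'rV[R]_m) x v j : derivable F x v ->
  'D_v (fun y => F y 0 j) x = 'D_v F x 0 j.
Proof. by move=> dF; rewrite derive_mx// mxE. Qed.

(** The chain rule in coordinates, the form in which an induction on the order of
    differentiability applies. *)
Lemma derive_comp_sum n m (F : 'rV[R]_n -> 'rV[R]_m) (g : 'rV[R]_m -> R) x v :
  differentiable F x -> differentiable g (F x) ->
  'D_v (g \o F) x = \sum_j 'D_v (fun y => F y 0 j) x * 'D_'e_j g (F x).
Proof.
move=> dF dg; rewrite deriveE; last exact: differentiable_comp.
rewrite diff_comp//= [X in 'd _ _ X]row_sum_delta raddf_sum; apply: eq_bigr => j _ /=.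
rewrite linearZ /= derive_coord; last exact: diff_derivable.
by rewrite !deriveE.
Qed.

Lemma Ck_comp n m k (U : set 'rV[R]_n) (V : set 'rV[R]_m)
    (F : 'rV[R]_n -> 'rV[R]_m) (g : 'rV[R]_m -> R) :
  open U -> open V -> (forall x, U x -> V (F x)) ->
  (forall j, Ck k U (fun x => F x 0 j)) -> Ck k V g -> Ck k U (g \o F).
Proof.
move=> oU oV FUV; elim: k g => [|k IH] g hF hg.
  split=> // x Ux; apply: continuous_comp; last exact: (hg.1 _ (FUV _ Ux)).
  by apply: continuous_rV => j; have [+ _] := hF j; apply.
have dF x : U x -> differentiable F x.
  by move=> Ux; apply: differentiable_rV => j; exact: Ck_diff (hF j) Ux.
have dg x : U x -> differentiable g (F x).
  by move=> Ux; apply: Ck_diff hg (FUV _ Ux).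
apply: (Ck_succ (g := fun i x => \sum_j 'D_'e_i (fun y => F y 0 j) x * 'D_'e_j g (F x)))
   => [//|x Ux|i|i x Ux].
- by apply: differentiable_comp; [exact: dF|exact: dg].
- apply: Ck_sum => // j; apply: CkM => //; first by have [_] := (hF j).2 i.
  apply: (IH ('D_'e_j g)); last by have [_] := hg.2 j.
  by move=> l; exact: Ck_mono.
- by rewrite derive_comp_sum//; [exact: dF|exact: dg].
Qed.

Lemma smooth_onP n m (U : set 'rV[R]_n) (F : 'rV[R]_n -> 'rV[R]_m) : open U ->
  smooth_on U F <-> forall k j, Ck k U (fun x => F x 0 j).
Proof.
move=> oU; split=> [sF k j|HF].
  pose G s x := iter_partial F s x 0 j.
  suff : forall s, Ck k U (G s) by move=> /(_ [::]).
  elim: k => [|k IH] s.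
    split=> // x /(sF s)[cF _].
    apply: (continuous_comp (g := fun M : 'rV[R]_m => M 0 j) cF); exact: coord_continuous.
  split=> [x /(sF s)[cF _]|i].
    apply: (continuous_comp (g := fun M : 'rV[R]_m => M 0 j) cF); exact: coord_continuous.
  split=> [x /(sF s)[_ /(_ i)/derivable_mxP dF]|]; first exact: dF.
  apply: (Ck_eq oU _ (IH (i :: s))) => x /(sF s)[_ /(_ i) dF].
  by rewrite /G/= derive_coord.
have H s : forall k j, Ck k U (fun x => iter_partial F s x 0 j).
  elim: s => [//|i s IH] k j /=.
  have [_ /(_ i)[d1 d2]] := IH k.+1 j.
  apply: Ck_eq d2 => // x Ux; rewrite derive_coord//.
  by apply/derivable_mxP => a b; rewrite (ord1 a); have [_ /(_ i)[+ _]] := IH 1%N b; apply.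
move=> s x Ux; split.
  by apply: continuous_rV => j; apply: Ck_cont (H s 0%N j) Ux.
move=> i; apply/derivable_mxP => a b; rewrite (ord1 a).
by have [_ /(_ i)[+ _]] := H s 1%N b; apply.
Qed.

Lemma smooth_on_comp n m l (U : set 'rV[R]_n) (V : set 'rV[R]_m)
   (F : 'rV[R]_n -> 'rV[R]_m) (G : 'rV[R]_m -> 'rV[R]_l) :
  open U -> open V -> (forall x, U x -> V (F x)) ->
  smooth_on U F -> smooth_on V G -> smooth_on U (G \o F).
Proof.
move=> oU oV FUV /(smooth_onP F oU) hF /(smooth_onP G oV) hG.
apply/smooth_onP => // k j; exact: (@Ck_comp _ _ _ U V F (fun y => G y 0 j)).
Qed.

Lemma smooth_on_eq n m (U : set 'rV[R]_n) (F G : 'rV[R]_n -> 'rV[R]_m) :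
  open U -> (forall x, U x -> F x = G x) -> smooth_on U F -> smooth_on U G.
Proof.
move=> oU FG /(smooth_onP F oU) hF; apply/smooth_onP => // k j.
by apply: Ck_eq (hF k j) => // x /FG ->.
Qed.

Lemma smooth_on_sub n m (U V : set 'rV[R]_n) (F : 'rV[R]_n -> 'rV[R]_m) :
  V `<=` U -> smooth_on U F -> smooth_on V F.
Proof. by move=> VU sF s x /VU; exact: sF. Qed.

Lemma smooth_on_local n m (U : set 'rV[R]_n) (F : 'rV[R]_n -> 'rV[R]_m) :
  (forall x, U x -> exists2 V, V x & smooth_on V F) -> smooth_on U F.
Proof. by move=> H s x /H[V Vx /(_ s x Vx)]. Qed.

Lemma smooth_on_differentiable n m (U : set 'rV[R]_n) (F : 'rV[R]_n -> 'rV[R]_m) x :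
  open U -> smooth_on U F -> U x -> differentiable F x.
Proof.
move=> oU /(smooth_onP F oU) hF Ux; apply: differentiable_rV => j.
exact: Ck_diff (hF 1%N j) Ux.
Qed.

Lemma smooth_on_continuous n m (U : set 'rV[R]_n) (F : 'rV[R]_n -> 'rV[R]_m) x :
  smooth_on U F -> U x -> {for x, continuous F}.
Proof. by move=> /(_ [::] x) sF /sF[]. Qed.

Lemma smooth_on_mulmx n m (U : set 'rV[R]_n) (A : 'M[R]_(n, m)) :
  open U -> smooth_on U (fun x => x *m A).
Proof.
move=> oU; apply/smooth_onP => // k j.
apply: (Ck_eq (f := fun x => \sum_i x 0 i * A i j)) => // [x _|]; first by rewrite mxE.
apply: Ck_sum => // i; apply: CkM => //; [exact: Ck_coord|exact: Ck_cst].
Qed.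

Lemma smooth_on_id n (U : set 'rV[R]_n) : open U -> smooth_on U id.
Proof. by move=> oU; apply/smooth_onP => // k j; exact: Ck_coord. Qed.

Lemma smooth_on_cst n m (U : set 'rV[R]_n) (a : 'rV[R]_m) : open U -> smooth_on U (fun=> a).
Proof. by move=> oU; apply/smooth_onP => // k j; exact: Ck_cst. Qed.

Lemma smooth_on_row_mx n m l (U : set 'rV[R]_n) (F : 'rV[R]_n -> 'rV[R]_m)
   (G : 'rV[R]_n -> 'rV[R]_l) : open U ->
  smooth_on U F -> smooth_on U G -> smooth_on U (fun x => row_mx (F x) (G x)).
Proof.
move=> oU /(smooth_onP F oU) hF /(smooth_onP G oU) hG; apply/smooth_onP => // k j.
have [i ->|i ->] := split_ordP j.
  by apply: Ck_eq (hF k i) => // x _; rewrite row_mxEl.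
by apply: Ck_eq (hG k i) => // x _; rewrite row_mxEr.
Qed.

Lemma smooth_on_lsubmx n m l (U : set 'rV[R]_n) (F : 'rV[R]_n -> 'rV[R]_(m + l)) : open U ->
  smooth_on U F -> smooth_on U (fun x => lsubmx (F x)).
Proof.
move=> oU /(smooth_onP F oU) hF; apply/smooth_onP => // k j.
by apply: Ck_eq (hF k (lshift l j)) => // x _; rewrite mxE.
Qed.

Lemma smooth_on_rsubmx n m l (U : set 'rV[R]_n) (F : 'rV[R]_n -> 'rV[R]_(m + l)) : open U ->
  smooth_on U F -> smooth_on U (fun x => rsubmx (F x)).
Proof.
move=> oU /(smooth_onP F oU) hF; apply/smooth_onP => // k j.
by apply: Ck_eq (hF k (rshift m j)) => // x _; rewrite mxE.
Qed.

Lemma open_preimage_on (V W : normedModType R) (U : set V) (F : V -> W) (O : set W) :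
  open U -> (forall x, U x -> {for x, continuous F}) -> open O -> open (U `&` F @^-1` O).
Proof.
move=> oU cF oO; rewrite openE => x [Ux Ox]; apply: filterI.
  exact: open_nbhs_nbhs.
by apply: (cF x Ux); exact: open_nbhs_nbhs.
Qed.
End CkCalculus.

(** * The inverse function theorem *)

Section IFT.
Variable R : realType.
Local Notation "''e_' i" := (delta_mx 0 i) (at level 8, i at level 2, format "''e_' i").

Lemma Ck_det n p k (U : set 'rV[R]_n) (M : 'rV[R]_n -> 'M[R]_p) :
  open U -> (forall i j, Ck k U (fun x => M x i j)) -> Ck k U (fun x => \det (M x)).
Proof.
move=> oU hM; apply: Ck_sum => // s; apply: CkM => //; first exact: Ck_cst.
exact: Ck_prod.
Qed.

(** Cramer's rule: the entries of the inverse matrix are quotients of polynomials in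
    the entries of the matrix. *)
Lemma Ck_invmx n p k (U : set 'rV[R]_n) (M : 'rV[R]_n -> 'M[R]_p) :
  open U -> (forall i j, Ck k U (fun x => M x i j)) ->
  (forall x, U x -> \det (M x) != 0) ->
  forall i j, Ck k U (fun x => invmx (M x) i j).
Proof.
move=> oU hM d0 i j.
apply: (Ck_eq (f := fun x => (\det (M x))^-1 * cofactor (M x) j i)) => // [x Ux|].
  by rewrite /invmx unitmxE unitfE d0// !mxE.
apply: CkM => //; first by apply: CkV => //; exact: Ck_det.
apply: CkM => //; first exact: Ck_cst.
by apply: Ck_det => // a b; apply: Ck_eq (hM (lift j a) (lift i b)) => // x _; rewrite !mxE.
Qed.

Lemma diff_estimate (V W : normedModType R) (f : V -> W) x e : differentiable f x -> 0 < e ->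
  \forall y \near x, `|f y - f x - 'd f x (y - x)| <= e * `|y - x|.
Proof.
move=> /diff_locally /eqaddoP h e0; have /near_dist[r r0 {}h] := h e e0.
apply/near_dist; exists r => // y yr.
by have := h (y - x); rewrite subr0 => /(_ yr) /=; rewrite !fctE subrK opprD addrA.
Qed.

Lemma jacobianE n m (f : 'rV[R]_n -> 'rV[R]_m) x i j : differentiable f x ->
  jacobian f x i j = 'D_'e_i (fun y => f y 0 j) x.
Proof.
move=> df; rewrite derive_coord; last exact: diff_derivable.
by rewrite deriveEjacobian// -rowE [RHS]mxE.
Qed.

Lemma Ck_jacobian n m (U : set 'rV[R]_n) (f : 'rV[R]_n -> 'rV[R]_m) i j k :
  open U -> smooth_on U f -> Ck k U (fun x => jacobian f x i j).
Proof.
move=> oU sf; have /(smooth_onP f oU) hf := sf.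
have [_ /(_ i)[_]] := hf k.+1 j; apply: Ck_eq => // x Ux.
by rewrite jacobianE//; exact: smooth_on_differentiable sf Ux.
Qed.

Lemma mulmxr_continuous n m (B : 'M[R]_(n, m)) :
  continuous (mulmxr B : 'rV[R]_n -> 'rV[R]_m).
Proof.
move=> x; apply: (@smooth_on_continuous _ _ _ setT (fun u : 'rV[R]_n => u *m B)) => //.
exact: smooth_on_mulmx openT.
Qed.

Lemma mulmx_bounded n m (B : 'M[R]_(n, m)) :
  exists2 C, 0 < C & forall u : 'rV[R]_n, `|u *m B| <= C * `|u|.
Proof.
have c := @mulmxr_continuous _ _ B.
have [C C0 H] := linear_lipschitz c; exists C => // u; exact: H.
Qed.

Section Inverse.
Variables (n : nat) (f : 'rV[R]_n -> 'rV[R]_n) (U : set 'rV[R]_n) (x0 : 'rV[R]_n).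
Hypotheses (oU : open U) (Ux0 : U x0) (sf : smooth_on U f) (J1 : jacobian f x0 = 1%:M).

(** Near [x0] the differential is close to the identity, so [f] differs from the
    identity by a map with Lipschitz constant 1/2. *)
Lemma inverse_radius : exists2 r, 0 < r &
  (forall x, `|x - x0| < r -> U x /\ \det (jacobian f x) != 0) /\
  (forall x y, `|x - x0| < r -> `|y - x0| < r ->
     `|f y - f x - (y - x)| <= 2^-1 * `|y - x|).
Proof.
(* [partial_increment] multiplies the bound on the partial derivatives by the
   dimension, and 1/2 must result; [n.+1] avoids dividing by zero when [n = 0]. *)
pose eps : R := (2 * n.+1%:R)^-1.
have eps0 : 0 < eps by rewrite invr_gt0 mulr_gt0.
have n1 : \forall x \near x0, U x by exact: open_nbhs_nbhs.
have n2 : \forall x \near x0, \det (jacobian f x) != 0.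
  have /cvgrPdist_lt : {for x0, continuous (fun x => \det (jacobian f x))}.
    apply: (Ck_cont (k := 0) (U := U)) => //; apply: Ck_det => // i j; exact: Ck_jacobian.
  rewrite J1 det1 => /(_ 1 ltr01); apply: filterS => x; apply: contraTneq => ->.
  by rewrite subr0 normr1 ltxx.
have n3 : \forall x \near x0, forall i j : 'I_n, `|jacobian f x i j - (i == j)%:R| <= eps.
  have H (ij : 'I_n * 'I_n) :
      \forall x \near x0, `|jacobian f x ij.1 ij.2 - (ij.1 == ij.2)%:R| <= eps.
    have /cvgrPdist_le/(_ _ eps0) : {for x0, continuous (fun x => jacobian f x ij.1 ij.2)}.
      by apply: (Ck_cont (k := 0) (U := U)) => //; exact: Ck_jacobian.
    by rewrite J1 mxE; apply: filterS => x; rewrite distrC.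
  have /(_ _) := @filter_forall _ _ _ (nbhs x0) _ H.
  by apply: filterS => x h i j; exact: (h (i, j)).
have /near_dist[r r0 H] : \forall x \near x0, U x /\ (\det (jacobian f x) != 0 /\
    forall i j : 'I_n, `|jacobian f x i j - (i == j)%:R| <= eps).
  by apply: filterS3 n1 n2 n3 => x.
exists r => //; split=> [x /H[? []//]|x y xr yr].
apply: norm_rV_le => [|j]; first by rewrite mulr_ge0.
have K z : `|z - x0| < r -> forall i, derivable (fun x => f x 0 j) z 'e_i /\
     `|'D_'e_i (fun x => f x 0 j) z - ('e_j : 'rV[R]_n) 0 i| <= eps.
  move=> /H[Uz [_ /(_ _ j) h]] i.
  have dfz := smooth_on_differentiable oU sf Uz.
  have ej : ('e_j : 'rV[R]_n) 0 i = (i == j)%:R by rewrite mxE.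
  split; last by rewrite -jacobianE// ej; exact: h.
  by move: (diff_derivable (v := 'e_i) dfz) => /derivable_mxP.
have := partial_increment K xr yr.
rewrite (bigD1 j)//= big1 => [|i ij]; last by rewrite mxE (negPf ij) andbF mul0r.
rewrite mxE !eqxx mul1r addr0 !mxE => h; apply: (le_trans h); rewrite ler_wpM2r//.
by rewrite /eps invfM mulrCA ler_piMr// ler_pdivrMr// mul1r ler_nat.
Qed.

(** Solving [f x = y] amounts to finding a fixed point of [x |-> x + (y - f x)],
    which maps a closed ball into itself and is a contraction.  By compactness
    [`|y - f x|] has a minimum on the ball, and applying that map to a minimiser
    halves this quantity, so the minimum is zero.  The inverse [g] is then
    Lipschitz, hence differentiable with the inverse Jacobian matrix; as
    [Dg = (Df o g)^-1], each order of differentiability of [g] gives the next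
    one. *)
Lemma local_inverse : exists (U' V : set 'rV[R]_n) (g : 'rV[R]_n -> 'rV[R]_n),
  [/\ [/\ open U', open V, U' x0 & U' `<=` U],
      (forall x, U' x -> V (f x) /\ g (f x) = x),
      (forall y, V y -> U' (g y) /\ f (g y) = y) & smooth_on V g].
Proof.
have [r r0 [rU rf]] := inverse_radius.
pose rho := r / 2; have rho0 : 0 < rho by rewrite divr_gt0.
have rhor : rho < r by rewrite /rho; lra.
pose V := [set y | `|y - f x0| < rho / 2].
pose B := [set x | `|x - x0| < rho].
have Br x : `|x - x0| <= rho -> `|x - x0| < r by move=> h; exact: le_lt_trans h rhor.
have x0r : `|x0 - x0| < r by rewrite subrr normr0.
have ballo (c : 'rV[R]_n) s : open [set x : 'rV[R]_n | `|x - c| < s].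
  rewrite (_ : [set _ | _] = ball c s); first exact: ball_open.
  by rewrite -ball_normE; apply/seteqP; split=> x /=; rewrite distrC.
have oV : open V by exact: ballo.
have oB : open B by exact: ballo.
have ex y : V y -> exists x, B x /\ f x = y.
  move=> Vy.
  have K0 : [set x | `|x - x0| <= rho] !=set0.
    by exists x0; rewrite /= subrr normr0 ltW.
  have Kc : compact [set x : 'rV[R]_n | `|x - x0| <= rho].
    apply: bounded_closed_compact.
      exists (`|x0| + rho); split=> [|M ltM x /= xK]; first by rewrite num_real.
      rewrite -(subrK x0 x) (le_trans (ler_normD _ _))// addrC.
      by apply: ltW; apply: le_lt_trans ltM; rewrite lerD2l.
    rewrite (_ : [set _ | _] = closed_ball x0 rho); first exact: closed_ball_closed.
    by rewrite closed_ballE// /closed_ball_; apply/seteqP; split=> x /=; rewrite distrC.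
  have Kf : {within [set x : 'rV[R]_n | `|x - x0| <= rho], continuous (fun x => `|y - f x|)}.
    apply: continuous_in_subspaceT => x /set_mem /Br/rU[Ux _].
    have cB : {for x, continuous (fun x => y - f x)}.
      apply: continuousB; first exact: cst_continuous.
      exact: smooth_on_continuous sf Ux.
    apply: (continuous_comp cB); exact: norm_continuous.
  have [c /set_mem cK cmin] := EVT_min_rV K0 Kc Kf.
  (* The image of the minimiser [c] under the contraction. *)
  pose x' := c + (y - f c).
  have x'r : `|x' - x0| < rho.
    have -> : x' - x0 = (y - f x0) - (f c - f x0 - (c - x0)).
      by apply/rowP => j; rewrite !mxE; ring.
    rewrite (le_lt_trans (ler_normB _ _))//.
    have := rf _ _ x0r (Br _ cK); rewrite /V/= in Vy; rewrite /= in cK; lra.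
  have : `|y - f x'| <= 2^-1 * `|y - f c|.
    have := rf _ _ (Br _ cK) (Br _ (ltW x'r)).
    have -> : x' - c = y - f c by rewrite /x' addrC addKr.
    have -> : y - f x' = - (f x' - f c - (y - f c)).
      by apply/rowP => j; rewrite !mxE; ring.
    by rewrite normrN.
  have := cmin x'; rewrite inE/= => /(_ (ltW x'r)) h1 h2.
  (* [`|y - f c| <= `|y - f x'| <= `|y - f c| / 2]. *)
  have yfc : y = f c.
    by apply/eqP; rewrite -subr_eq0 -normr_eq0; have := normr_ge0 (y - f c); lra.
  exists c; split=> //; move: x'r; rewrite /x' yfc subrr addr0//.
pose U' := B `&` f @^-1` V.
have BU x : B x -> U x by move=> /ltW/Br/rU[].
have oU' : open U'.
  apply: open_preimage_on => // x /BU Ux; exact: smooth_on_continuous sf Ux.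
have lip x y : B x -> B y -> `|x - y| <= 2 * `|f x - f y|.
  move=> /ltW/Br xr /ltW/Br yr; have := rf _ _ yr xr.
  have := ler_normB (f x - f y) (f x - f y - (x - y)); rewrite opprB addrC subrK.
  lra.
have [g gP] : exists g, forall y, V y -> B (g y) /\ f (g y) = y.
  have [y|g gP] := @boolp.choice _ _ (fun y x => V y -> B x /\ f x = y); last by exists g.
  by have [/ex[x xP]|nV] := pselect (V y); [exists x|exists x0].
exists U', V, g; split.
- split=> //; last by move=> x [/BU].
  by split; rewrite /B/V/= subrr normr0// divr_gt0.
- move=> x [Bx Vfx]; split=> //; have [Bg fg] := gP _ Vfx.
  apply/eqP; rewrite -subr_eq0 -normr_le0 (le_trans (lip _ _ Bg Bx))//.
  by rewrite fg subrr normr0 mulr0.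
- by move=> y Vy; have [Bg fg] := gP _ Vy; split=> //; split=> //=; rewrite fg.
(* From [lip]: the inverse is Lipschitz with constant 2, which is what turns an
   estimate in terms of [g z - g y] into one in terms of [z - y]. *)
have lipg y z : V y -> V z -> `|g y - g z| <= 2 * `|y - z|.
  by move=> /gP[By fy] /gP[Bz fz]; have := lip _ _ By Bz; rewrite fy fz.
have dg y : V y -> differentiable g y /\
    'd g y = mulmxr (invmx (jacobian f (g y))) :> ('rV[R]_n -> 'rV[R]_n).
  move=> Vy; have [Bg fg] := gP _ Vy.
  set A := jacobian f (g y).
  have uA : A \in unitmx by rewrite unitmxE unitfE; have /ltW/Br/rU[] := Bg.
  apply: (@diff_of_estimate _ _ _ g y (mulmxr (invmx A))) => [|e e0].
    exact: mulmxr_continuous.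
  have [C C0 HC] := mulmx_bounded (invmx A).
  have dfx : differentiable f (g y) by exact: smooth_on_differentiable sf (BU _ Bg).
  have e'0 : 0 < e / (2 * C) by rewrite divr_gt0// mulr_gt0.
  have /near_dist[s s0 Hs] := diff_estimate dfx e'0.
  have /near_dist[t t0 Ht] : \forall z \near y, V z by exact: open_nbhs_nbhs.
  apply/near_dist; exists (Num.min t (s / 2)); first by rewrite lt_min t0 divr_gt0.
  move=> z; rewrite lt_min => /andP[/Ht Vz zs].
  have zg := lipg _ _ Vz Vy.
  have := Hs (g z) _; rewrite (gP _ Vz).2 fg -deriveE// deriveEjacobian// -/A.
  have -> : `|g z - g y| < s by rewrite (le_lt_trans zg)//; lra.
  move=> /(_ isT) h.
  have -> : g z - g y - mulmxr (invmx A) (z - y) =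
      - ((z - y - (g z - g y) *m A) *m invmx A).
    by rewrite /= [in RHS]mulmxBl -mulmxA mulmxV// mulmx1 opprB.
  rewrite normrN (le_trans (HC _))//.
  apply: (@le_trans _ _ (C * (e / (2 * C) * (2 * `|z - y|)))).
    rewrite ler_pM2l// (le_trans h)// ler_pM2l//.
  rewrite (_ : C * _ = e * `|z - y|)//; field.
  by rewrite gt_eqF.
apply/smooth_onP => // k j; elim: k j => [|k IH] j.
  split=> // y Vy; have [dgy _] := dg y Vy.
  apply: (continuous_comp (g := fun M : 'rV[R]_n => M 0 j)); last exact: coord_continuous.
  exact: differentiable_continuous.
apply: (Ck_succ (g := fun i y => invmx (jacobian f (g y)) i j)) => [//|y Vy|i|i y Vy].
- have [dgy _] := dg y Vy.
  by apply: (differentiable_comp (g := fun M : 'rV[R]_n => M 0 j)) => //;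
    exact: differentiable_coord.
- apply: Ck_invmx => // [a b|y /gP[/ltW/Br/rU[]//]].
  apply: (@Ck_comp _ _ _ _ V U g (fun x => jacobian f x a b)) => //.
    by move=> y /gP[/BU].
  exact: Ck_jacobian.
- have [dgy E] := dg y Vy.
  rewrite derive_coord; last exact: diff_derivable.
  by rewrite deriveE// E /= -rowE mxE.
Qed.
End Inverse.
End IFT.

(** * Straightening submersions of Euclidean domains *)

Section Submersion.
Variable R : realType.

(** A surjective linear map [D] is completed to an isomorphism by adding coordinates
    [K] along its kernel: [row_mx D K] and [col_mx D' N] are inverse to each other,
    the rows of [N] being a basis of the kernel and [D'] a section of [D].  The
    isomorphism between R^n and R^(m + k) is thus carried by the two matrices,
    and not by an equality of dimensions. *)
Lemma row_full_split n m (D : 'M[R]_(n, m)) : row_full D ->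
  exists k (D' : 'M[R]_(m, n)) (N : 'M[R]_(k, n)) (K : 'M[R]_(n, k)),
    D *m D' + K *m N = 1%:M /\ col_mx D' N *m row_mx D K = 1%:M.
Proof.
move=> /row_fullP[D' D'D]; set N := row_base (kermx D).
have ND : N *m D = 0.
  by apply/sub_kermxP; rewrite eq_row_base.
have Nf : row_free N by exact: row_base_free.
exists _, D', N, ((1%:M - D *m D') *m pinvmx N).
set K := (_ *m pinvmx N).
have KN : K *m N = 1%:M - D *m D'.
  rewrite mulmxKpV// eq_row_base; apply/sub_kermxP.
  by rewrite mulmxBl mul1mx -mulmxA D'D mulmx1 subrr.
split; first by rewrite KN addrC subrK.
rewrite mul_col_row D'D ND.
have -> : D' *m K = 0.
  apply: (row_free_inj Nf); rewrite mul0mx -mulmxA KN mulmxBr mulmx1 mulmxA D'D mul1mx subrr//.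
have -> : N *m K = 1%:M.
  apply: (row_free_inj Nf); rewrite mul1mx -mulmxA KN mulmxBr mulmx1 mulmxA ND mul0mx subr0//.
by rewrite -scalar_mx_block.
Qed.

(** The local form of submersions.  Adding linear coordinates along the kernel of
    the differential to [f] gives a map [phi] with invertible differential, of
    which [f] is the first component.  The inverse function theorem is applied to
    [phi] followed by the inverse of its differential at [x0], a map from ['rV_n]
    to itself. *)
Lemma submersion_straighten n m (f : 'rV[R]_n -> 'rV[R]_m) (U : set 'rV[R]_n) x0 :
  open U -> U x0 -> smooth_on U f -> (forall w, exists v, 'd f x0 v = w) ->
  exists k (U' : set 'rV[R]_n) (W : set 'rV[R]_(m + k)) phi psi,
    [/\ [/\ open U', open W, U' x0 & U' `<=` U],
      (forall x, U' x -> W (phi x) /\ psi (phi x) = x),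
      (forall w, W w -> U' (psi w) /\ phi (psi w) = w),
      smooth_on U' phi /\ smooth_on W psi &
      forall x, U' x -> lsubmx (phi x) = f x].
Proof.
move=> oU Ux0 sf sd; pose D := jacobian f x0.
have dD v : 'd f x0 v = v *m D by rewrite /D/jacobian mul_rV_lin1.
have fD : row_full D.
  rewrite -sub1mx; apply/row_subP => i; have [v <-] := sd (row i 1%:M).
  by rewrite dD submxMl.
have [k [D' [N [K [e1 e2]]]]] := row_full_split fD.
pose phi x := row_mx (f x) (x *m K).
pose h x := phi x *m col_mx D' N.
have hE x : h x = f x *m D' + x *m (K *m N) by rewrite /h mul_row_col mulmxA.
have sphi : smooth_on U phi.
  by apply: smooth_on_row_mx => //; exact: smooth_on_mulmx.
have sh : smooth_on U h.
  apply: (@smooth_on_comp _ _ _ _ U setT phi (fun y => y *m col_mx D' N)) => //.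
    exact: openT.
  exact: smooth_on_mulmx openT.
have df : differentiable f x0 by exact: smooth_on_differentiable sf Ux0.
have J1 : jacobian h x0 = 1%:M.
  have -> : h = (mulmxr D' \o f) + mulmxr (K *m N).
    by apply/funext => x; rewrite hE.
  have lin p q (B : 'M[R]_(p, q)) (x : 'rV[R]_p) : differentiable (mulmxr B) x.
    by apply: linear_differentiable; exact: mulmxr_continuous.
  have lind p q (B : 'M[R]_(p, q)) (x : 'rV[R]_p) :
      'd (mulmxr B) x = mulmxr B :> ('rV[R]_p -> 'rV[R]_q).
    by apply: diff_lin; exact: mulmxr_continuous.
  have dc : differentiable (mulmxr D' \o f) x0 by exact: differentiable_comp.
  have dE := diff_comp df (lin _ _ D' (f x0)).
  have dS := diffD dc (lin _ _ (K *m N) x0).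
  have dv v : 'd ((mulmxr D' \o f) + mulmxr (K *m N)) x0 v = v.
    rewrite dS.
    transitivity (('d f x0 v) *m D' + v *m (K *m N)).
      congr (_ + _); last by rewrite lind.
      by rewrite dE /comp lind.
    by rewrite dD -mulmxA -mulmxDr e1 mulmx1.
  by apply/row_matrixP => i; rewrite rowE mul_rV_lin1 /= dv rowE mulmx1.
have [U' [V [g [[oU' oV U'x0 U'U] hV gV sg]]]] := local_inverse oU Ux0 sh J1.
exists k, U', [set w | V (w *m col_mx D' N)], phi, (fun w => g (w *m col_mx D' N)).
have oW : open [set w | V (w *m col_mx D' N)].
  have := open_preimage_on openT (fun x _ => @mulmxr_continuous _ _ _ (col_mx D' N) x) oV.
  by rewrite setTI.
split; [by split|exact: hV| | |].
- move=> w /gV[gU hg]; split=> //.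
  by rewrite -[LHS]mulmx1 -e2 mulmxA -/(h _) hg -mulmxA e2 mulmx1.
- split; first exact: smooth_on_sub U'U sphi.
  apply: (@smooth_on_comp _ _ _ _ _ V (fun y => y *m col_mx D' N) g) => //.
  exact: smooth_on_mulmx.
- by move=> x _; rewrite row_mxKl.
Qed.
End Submersion.

(** * Manifolds as diffeological spaces *)

Section Diffeology.
Variable R : realType.
Implicit Types X Y Z : diffspace R.

(** R^n with its standard diffeology, so that charts and plots are themselves smooth
    maps between diffeological spaces. *)
Definition eucl (n : nat) : diffspace R.
Proof.
apply: (@DiffSpace R 'rV[R]_n (fun m U p => open U /\ smooth_on U p)).
- by move=> m U p [].
- by move=> m U p q pq [oU sp]; split; [|exact: (smooth_on_eq oU pq sp)].
- by move=> m U a oU; split=> //; exact: smooth_on_cst.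
- move=> m C p Cp; split; first by apply: bigcup_open => V /Cp[].
  by apply: smooth_on_local => x [V CV Vx]; exists V => //; have [_ []] := Cp V CV.
- move=> m l U p V f [oU sp] oV sf fVU; split=> //.
  by apply: (smooth_on_comp oV oU) sf sp => x Vx; apply: fVU; exists x.
Defined.

Lemma plot_sub X n (U V : set 'rV[R]_n) (p : 'rV[R]_n -> X) :
  plot U p -> open V -> V `<=` U -> plot V p.
Proof.
move=> pU oV VU; apply: (plot_comp pU oV (smooth_on_id oV)).
by move=> _ [x Vx <-]; exact: VU.
Qed.

Lemma plot_locally X n (U : set 'rV[R]_n) (p : 'rV[R]_n -> X) :
  (forall x, U x -> exists V, [/\ V x, V `<=` U & plot V p]) -> plot U p.
Proof.
move=> H; have -> : U = \bigcup_(V in [set V | V `<=` U /\ plot V p]) V.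
  apply/seteqP; split=> [x /H[V [Vx VU pV]]|x [V [VU _] /VU//]].
  by exists V.
by apply: plot_local => V [_ pV]; split=> //; exact: plot_open pV.
Qed.

(** The D-topology, given by its open sets; on a manifold it is the manifold topology
    ([dopen_atlas]). *)
Definition dopen X (O : set X) : Prop :=
  forall n (U : set 'rV[R]_n) (p : 'rV[R]_n -> X), plot U p -> open (U `&` p @^-1` O).

(** Smoothness on a subset of a total function, for the subset diffeology. *)
Definition dsmooth_on X Y (D : set X) (F : X -> Y) : Prop :=
  forall n (U : set 'rV[R]_n) (p : 'rV[R]_n -> X),
    plot U p -> (forall u, U u -> D (p u)) -> plot U (F \o p).

Lemma diff_smooth_on X Y (D : set X) (F : X -> Y) : diff_smooth F -> dsmooth_on D F.
Proof. by move=> sF n U p pU _; exact: sF. Qed.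

Lemma dsmooth_on_sub X Y (D E : set X) (F : X -> Y) :
  E `<=` D -> dsmooth_on D F -> dsmooth_on E F.
Proof. by move=> ED sF n U p pU Ep; apply: sF => // u /Ep/ED. Qed.

Lemma dsmooth_on_comp X Y Z (D : set X) (E : set Y) (F : X -> Y) (G : Y -> Z) :
  (forall x, D x -> E (F x)) -> dsmooth_on D F -> dsmooth_on E G ->
  dsmooth_on D (fun x => G (F x)).
Proof.
move=> FDE sF sG n U p pU Dp; apply: (sG n U (F \o p)); first exact: sF.
by move=> u /Dp/FDE.
Qed.

Lemma dsmooth_id X (D : set X) : dsmooth_on D id.
Proof. by move=> n U p pU _; apply: plot_ext pU. Qed.

Lemma dsmooth_pair X Y Z (D : set X) (F : X -> Y) (G : X -> Z) :
  dsmooth_on D F -> dsmooth_on D G ->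
  dsmooth_on (Y := prod_space Y Z) D (fun x => (F x, G x)).
Proof. by move=> sF sG n U p pU Dp; split; [exact: sF|exact: sG]. Qed.

Lemma dsmooth_fst X Y (D : set (X * Y)) : dsmooth_on (X := prod_space X Y) D fst.
Proof. by move=> n U p [p1 p2] _. Qed.

Lemma dsmooth_snd X Y (D : set (X * Y)) : dsmooth_on (X := prod_space X Y) D snd.
Proof. by move=> n U p [p1 p2] _. Qed.

Lemma dopenT X : dopen (@setT X).
Proof. by move=> n U p /plot_open; rewrite preimage_setT setIT. Qed.

(** Preimages under partially defined smooth maps; together with the lemmas on
    [dsmooth_on] this reduces every openness claim below to the construction of
    the set. *)
Lemma dopen_preimage_on X Y (D : set X) (F : X -> Y) (O : set Y) :
  dopen D -> dsmooth_on D F -> dopen O -> dopen (fun x => D x /\ O (F x)).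
Proof.
move=> oD sF oO n U p pU; have oU1 := oD n U p pU.
have p1 : plot (U `&` p @^-1` D) p by apply: plot_sub pU oU1 _ => x [].
have := oO _ _ _ (sF _ _ _ p1 (fun u h => h.2)).
by congr open; apply/seteqP; split=> x; rewrite /preimage/=; tauto.
Qed.

Lemma dopen_preimage X Y (F : X -> Y) (O : set Y) :
  diff_smooth F -> dopen O -> dopen (fun x => O (F x)).
Proof. by move=> sF oO n U p pU; exact: oO (sF _ _ _ pU). Qed.

Lemma dopen_euclE n (O : set 'rV[R]_n) : dopen (X := eucl n) O <-> open O.
Proof.
split=> [/(_ n setT id)|oO m U p [oU sp]].
  by rewrite setTI; apply; split; [exact: openT|exact: (smooth_on_id openT)].
by apply: open_preimage_on => // x Ux; exact: smooth_on_continuous sp Ux.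
Qed.

Lemma plotE X n (W : set 'rV[R]_n) (p : 'rV[R]_n -> X) :
  plot W p <-> open W /\ dsmooth_on (X := eucl n) W p.
Proof.
split=> [pW|[oW sp]].
  split=> [|m U q [oU sq] qW]; first exact: plot_open pW.
  by apply: (plot_comp pW) => // _ [u Uu <-]; exact: qW.
by apply: (sp n W id) => //; split=> //; exact: smooth_on_id.
Qed.

Lemma smooth_onE n m (W : set 'rV[R]_n) (F : 'rV[R]_n -> 'rV[R]_m) : open W ->
  smooth_on W F <-> dsmooth_on (X := eucl n) (Y := eucl m) W F.
Proof.
move=> oW; have := @plotE (eucl m) n W F; rewrite /=; tauto.
Qed.

Lemma dsmooth_row X n m (D : set X) (F : X -> 'rV[R]_n) (G : X -> 'rV[R]_m) :
  dsmooth_on (Y := eucl n) D F -> dsmooth_on (Y := eucl m) D G ->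
  dsmooth_on (Y := eucl (n + m)) D (fun x => row_mx (F x) (G x)).
Proof.
move=> sF sG k U p pU Dp; have [oU s1] := sF _ _ _ pU Dp; have [_ s2] := sG _ _ _ pU Dp.
by split=> //; exact: smooth_on_row_mx.
Qed.

Lemma dsmooth_lsub n m (D : set 'rV[R]_(n + m)) :
  dsmooth_on (X := eucl (n + m)) (Y := eucl n) D lsubmx.
Proof. by move=> k U p [oU sp] Dp; split=> //; exact: smooth_on_lsubmx. Qed.

Lemma dsmooth_rsub n m (D : set 'rV[R]_(n + m)) :
  dsmooth_on (X := eucl (n + m)) (Y := eucl m) D rsubmx.
Proof. by move=> k U p [oU sp] Dp; split=> //; exact: smooth_on_rsubmx. Qed.

(** A chart adapted to a diffeology: a diffeomorphism, with inverse [psi], from the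
    D-open set [D] onto the open set [W].  It is kept apart from [chart] so that
    its dimension may be given as a sum. *)
Record gchart X n (D : set X) (W : set 'rV[R]_n) (phi : X -> 'rV[R]_n)
    (psi : 'rV[R]_n -> X) : Prop := GChart {
  gdom : dopen D;
  gimg : open W;
  gphi : dsmooth_on (Y := eucl n) D phi;
  gpsi : dsmooth_on (X := eucl n) W psi;
  gphiW : forall x, D x -> W (phi x);
  gpsiD : forall w, W w -> D (psi w);
  gphiK : forall x, D x -> psi (phi x) = x;
  gpsiK : forall w, W w -> phi (psi w) = w }.

Lemma gchart_plot X n (D : set X) (W : set 'rV[R]_n) phi psi :
  gchart D W phi psi -> plot W psi.
Proof. by move=> g; apply/plotE; split; [exact: gimg g|exact: gpsi g]. Qed.

(** On a manifold, the maximal atlas. *)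
Definition good_atlas X : atlas R X :=
  [set c | gchart (chart_dom c) (chart_img c) c (chart_inv c)].
Arguments good_atlas : clear implicits.

(** Transition maps are smooth because the inverse of one chart is a plot, to which
    the other chart applies; a parametrisation that is smooth in the charts is
    locally the composite of a plot [chart_inv c] with a smooth map. *)
Lemma manifold_of_gcharts X (A : atlas R X) : A `<=` good_atlas X ->
  (forall x, exists2 c, A c & chart_dom c x) -> manifold_structure A.
Proof.
move=> Ag Acov.
have atl : smooth_atlas A.
  split=> // c d /Ag gc /Ag gd W.
  have pc : plot (chart_img c) (chart_inv c).
    exact: gchart_plot gc.
  have oW : open W by exact: (gdom gd pc).
  split=> //; have pW : plot W (chart_inv c) by apply: plot_sub pc oW _ => x [].
  by have [] := gphi gd pW (fun u h => h.2).
split=> // n U p; split=> [pU|[oU cp sp]].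
  split; first exact: plot_open pU.
  - move=> x Ux; have [c Ac cx] := Acov (p x); have gc := Ag _ Ac.
    have oU1 : open (U `&` p @^-1` chart_dom c) := gdom gc pU.
    have pU1 : plot (U `&` p @^-1` chart_dom c) p by apply: plot_sub pU oU1 _ => y [].
    have [_ s1] := gphi gc pU1 (fun u h => h.2).
    move=> O /=; rewrite nbhsE => [] [P [oP Px] PO].
    have o2 := open_preimage_on oU1 (fun y h => smooth_on_continuous s1 h) (oP c Ac).
    have : nbhs x ((U `&` p @^-1` chart_dom c) `&`
        (c \o p) @^-1` (chart_img c `&` chart_inv c @^-1` P)).
      apply: open_nbhs_nbhs; split=> //; split=> //; split; first exact: (gphiW gc cx).
      by rewrite /preimage/= chart_mapK.
    by apply: filterS => y [[_ cy] [_]]; rewrite /preimage/= chart_mapK// => /PO.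
  - move=> c /Ag gc; have oU1 : open (U `&` p @^-1` chart_dom c) := gdom gc pU.
    have pU1 : plot (U `&` p @^-1` chart_dom c) p by apply: plot_sub pU oU1 _ => y [].
    by have [_] := gphi gc pU1 (fun u h => h.2).
apply: plot_locally => x Ux; have [c Ac cx] := Acov (p x); have gc := Ag _ Ac.
have oc : open (chart_dom c : set (atlas_space A)).
  by move=> d Ad; have [_ /(_ d c Ad Ac) []] := atl.
have oU1 : open (U `&` p @^-1` chart_dom c).
  rewrite openE => y [Uy cy]; apply: filterI; first exact: (open_nbhs_nbhs (conj oU Uy)).
  by apply: (cp y Uy); exact: (open_nbhs_nbhs (conj oc cy)).
exists (U `&` p @^-1` chart_dom c); split; [by []|by move=> y []|].
have pc : plot (chart_img c) (chart_inv c).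
  exact: gchart_plot gc.
apply: (plot_ext (p := chart_inv c \o (c \o p))).
  by move=> y [_ cy] /=; rewrite chart_mapK.
apply: plot_comp pc oU1 (sp c Ac) _ => _ [y [_ cy] <-]; exact: chart_mapP.
Qed.

(** The inverse of a chart is a smooth parametrisation by the compatibility of the
    charts, hence a plot. *)
Lemma gchart_of_manifold X (A : atlas R X) : manifold_structure A -> A `<=` good_atlas X.
Proof.
move=> [[cov ov] pl] c Ac.
have oc : open (chart_dom c : set (atlas_space A)).
  by move=> d Ad; have [] := ov d c Ad Ac.
split.
- move=> n U p /pl[oU cp _]; rewrite openE => y [Uy cy].
  apply: filterI; first exact: open_nbhs_nbhs.
  by apply: (cp y Uy); exact: (open_nbhs_nbhs (conj oc cy)).
- exact: chart_open.
- move=> n U p /pl[oU _ /(_ c Ac) sp] Up; split=> //.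
  by apply: smooth_on_sub sp => u Uu; split=> //; exact: Up.
- suff /plotE[] : plot (chart_img c) (chart_inv c) by [].
  apply/pl; split; first exact: chart_open.
    move=> x cx O /=; rewrite nbhsE => [] [P [oP Px] PO].
    have := open_nbhs_nbhs (conj (oP c Ac) (conj cx Px)).
    by apply: filterS => y [_ /PO].
  by move=> d Ad; have [] := ov c d Ac Ad.
- exact: chart_mapP.
- exact: chart_invP.
- exact: chart_mapK.
- exact: chart_invK.
Qed.

Lemma good_atlas_manifold X :
  (forall x : X, exists n D (W : set 'rV[R]_n) phi psi, gchart D W phi psi /\ D x) ->
  manifold_structure (good_atlas X).
Proof.
move=> H; apply: manifold_of_gcharts => // x.
have [n [D [W [phi [psi [g Dx]]]]]] := H x.
by exists (Chart (gimg g) (gphiW g) (gpsiD g) (gphiK g) (gpsiK g)).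
Qed.

Lemma manifold_gchart X (A : atlas R X) (x : X) : manifold_structure A ->
  exists n D (W : set 'rV[R]_n) phi psi, gchart D W phi psi /\ D x.
Proof.
move=> mA; have [c Ac cx] := mA.1.1 x.
exists (chart_dim c), (chart_dom c), (chart_img c), c, (chart_inv c).
by split; [exact: (gchart_of_manifold mA Ac)|].
Qed.

Lemma dopen_atlas X (A : atlas R X) (O : set X) : manifold_structure A ->
  dopen O <-> open (O : set (atlas_space A)).
Proof.
move=> mA; split=> [oO|oO n U p /mA.2[oU cp _]].
  suff : @atlas_open R X A O by [].
  move=> c Ac; have gc := gchart_of_manifold mA Ac; apply: oO.
  exact: gchart_plot gc.
rewrite openE => y [Uy cy]; apply: filterI; first exact: (open_nbhs_nbhs (conj oU Uy)).
by apply: (cp y Uy); exact: open_nbhs_nbhs.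
Qed.

Lemma diff_smooth_map X Y (A : atlas R X) (B : atlas R Y) (f : X -> Y) :
  manifold_structure A -> manifold_structure B -> diff_smooth f -> smooth_map A B f.
Proof.
move=> mA mB sf; split.
  apply/continuousP => O oO; apply/(dopen_atlas _ mA).
  by apply: (dopen_preimage sf); exact/(dopen_atlas _ mB).
move=> c d /(gchart_of_manifold mA) gc /(gchart_of_manifold mB) gd.
have pc : plot (chart_img c) (f \o chart_inv c).
  by apply: sf; exact: gchart_plot gc.
have o1 := gdom gd pc.
have p1 : plot (chart_img c `&` (f \o chart_inv c) @^-1` chart_dom d) (f \o chart_inv c).
  by apply: plot_sub pc o1 _ => x [].
by have [] := gphi gd p1 (fun u h => h.2).
Qed.

Lemma diffeo_manifold X Y (A : atlas R X) (B : atlas R Y) (f : X -> Y) :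
  manifold_structure A -> manifold_structure B -> diffeomorphism f -> manifold_diffeo A B f.
Proof.
move=> mA mB [sf [f' sf' K]]; split; first exact: diff_smooth_map.
by exists f' => //; exact: diff_smooth_map.
Qed.
End Diffeology.
Arguments good_atlas {R} X _.

(** * Submersions, local sections and local products *)

Section Manifolds.
Variable R : realType.
Implicit Types X Y Z M S : diffspace R.

(** The chain rule for [G \o F = id].  It serves both for submersions, where [F]
    comes from a section, and for immersions, where [G] comes from a retraction. *)
Lemma diff_left_inverse n m (F : 'rV[R]_n -> 'rV[R]_m) (G : 'rV[R]_m -> 'rV[R]_n)
    (W : set 'rV[R]_n) y : open W -> W y -> (forall x, W x -> G (F x) = x) ->
  differentiable F y -> differentiable G (F y) ->
  forall w, 'd G (F y) ('d F y w) = w.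
Proof.
move=> oW Wy GF dF dG w.
have dc := differentiable_comp dF dG.
have := deriveE w dc; rewrite (diff_comp dF dG) => E.
rewrite -[LHS]/(('d G (F y) \o 'd F y) w) -E.
have -> : 'D_w (G \o F) y = 'D_w id y.
  by apply: near_eq_derive; exact: (near_of_open (P := fun x => (G \o F) x = id x) oW Wy GF).
exact: derive_id.
Qed.

(** Maps defined on a D-open set only, since sections and retractions are local. *)
Lemma coord_rep_smooth X Y (A : atlas R X) (B : atlas R Y) (f : X -> Y)
    (c : chart R X) (d : chart R Y) (O : set X) :
  manifold_structure A -> manifold_structure B -> A c -> B d ->
  dopen O -> dsmooth_on O f ->
  let W := chart_img c `&` chart_inv c @^-1` (fun x => O x /\ chart_dom d (f x)) in
  open W /\ smooth_on W (d \o f \o chart_inv c).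
Proof.
move=> mA mB /(gchart_of_manifold mA) gc /(gchart_of_manifold mB) gd oO sf W.
have pc : plot (chart_img c) (chart_inv c).
  exact: gchart_plot gc.
have oW : open W by apply: (dopen_preimage_on oO sf (gdom gd)) pc.
split=> //.
have pW : plot W (chart_inv c) by apply: plot_sub pc oW _ => x [].
have pf : plot W (f \o chart_inv c) by apply: sf pW _ => u [_ []].
by have [] := gphi gd pf (fun u h => h.2.2).
Qed.

(** In charts, the differential of the section [s] is a right inverse of that of
    [f]. *)
Lemma submersion_of_sections X Z (A : atlas R X) (B : atlas R Z) (f : X -> Z) :
  manifold_structure A -> manifold_structure B -> diff_smooth f ->
  (forall x, exists O s, [/\ dopen O, O (f x), dsmooth_on O s, s (f x) = x &
     forall z, O z -> f (s z) = z]) ->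
  submersion A B f.
Proof.
move=> mA mB sf H; split; first exact: diff_smooth_map.
move=> c d x Ac Bd cx dfx w.
have [N [s [oO Ofx ss sfx fs]]] := H x.
have [oW1 s1] := coord_rep_smooth mA mB Ac Bd (@dopenT _ X) (diff_smooth_on sf).
have [oW2 s2] := coord_rep_smooth mB mA Bd Ac oO ss.
have cE : chart_inv c (c x) = x by rewrite chart_mapK.
have dE : chart_inv d (d (f x)) = f x by rewrite chart_mapK.
have E : (c \o s \o chart_inv d) (d (f x)) = c x by rewrite /= dE sfx.
have dfx1 : differentiable (coord_rep c d f) ((c \o s \o chart_inv d) (d (f x))).
  rewrite E; apply: (smooth_on_differentiable oW1 s1).
  by split; [exact: chart_mapP|rewrite /preimage/= cE].
have dsx : differentiable (c \o s \o chart_inv d) (d (f x)).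
  apply: (smooth_on_differentiable oW2 s2).
  by split; [exact: chart_mapP|rewrite /preimage/= dE sfx].
exists ('d (c \o s \o chart_inv d) (d (f x)) w).
rewrite -[in LHS]E; apply: (diff_left_inverse oW2) => //.
  by split; [exact: chart_mapP|rewrite /preimage/= dE sfx].
move=> v [dv [Odv cdv]]; rewrite /coord_rep /= chart_mapK// fs//.
exact: chart_invK.
Qed.

(** Near [x0] the manifold is a product of its image and of R^k: [(f, rho)] is a
    diffeomorphism from [D] onto the D-open set [E] of [Z * R^k], with inverse
    [sec].  For fixed [w], [z |-> sec (z, w)] is a local section of [f], and
    varying [z] moves a point from one fibre of [f] to another.  Stating the local
    form of submersions this way makes no reference to the charts of [X] and
    [Z]. *)
Lemma submersion_local_product X Z (A : atlas R X) (B : atlas R Z) (f : X -> Z) (x0 : X) :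
  manifold_structure A -> manifold_structure B -> diff_smooth f -> submersion A B f ->
  exists k (D : set X) (rho : X -> 'rV[R]_k) (E : set (Z * 'rV[R]_k)) (sec : Z * 'rV[R]_k -> X),
   [/\ [/\ dopen D, D x0 & dsmooth_on (Y := eucl R k) D rho],
     dopen (X := prod_space Z (eucl R k)) E /\
     dsmooth_on (X := prod_space Z (eucl R k)) E sec,
     (forall z w, E (z, w) -> [/\ D (sec (z, w)), f (sec (z, w)) = z & rho (sec (z, w)) = w]) &
     (forall x, D x -> E (f x, rho x) /\ sec (f x, rho x) = x)].
Proof.
move=> mA mB sf [_ subf].
have [c Ac cx] := mA.1.1 x0; have [d Bd dfx] := mB.1.1 (f x0).
have gc := gchart_of_manifold mA Ac; have gd := gchart_of_manifold mB Bd.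
have [oW1 s1] := coord_rep_smooth mA mB Ac Bd (@dopenT _ X) (diff_smooth_on sf).
set U0 := (X in open X) in oW1 s1.
have cE : chart_inv c (c x0) = x0 by rewrite chart_mapK.
have Ucx : U0 (c x0) by split; [exact: chart_mapP|rewrite /preimage/= cE].
have [k [U [W [phi [psi [[oU oW Ux UU0] hU hW [sphi spsi] lphi]]]]]] :=
  submersion_straighten oW1 Ucx s1 (subf c d x0 Ac Bd cx dfx).
have sphiE : dsmooth_on (X := eucl R _) (Y := eucl R _) U phi by exact/smooth_onE.
have spsiE : dsmooth_on (X := eucl R _) (Y := eucl R _) W psi by exact/smooth_onE.
pose D x := chart_dom c x /\ U (c x).
pose row (p : Z * 'rV[R]_k) := row_mx (d p.1) p.2.
exists k, D, (fun x => rsubmx (phi (c x))).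
exists (fun p => chart_dom d p.1 /\ W (row p)), (fun p => chart_inv c (psi (row p))).
have srow : dsmooth_on (X := prod_space Z (eucl R k)) (Y := eucl R _)
    (fun p => chart_dom d p.1) row.
  apply: dsmooth_row; last exact: dsmooth_snd.
  apply: (dsmooth_on_comp (E := chart_dom d) _ _ (gphi gd)) => [p //|]; exact: dsmooth_fst.
have lD x : D x -> chart_dom d (f x) /\ lsubmx (phi (c x)) = d (f x).
  move=> [cx' Ux']; have [_ [_]] := UU0 _ Ux'; rewrite lphi//.
  by rewrite /= chart_mapK.
split.
- split=> //.
    apply: (dopen_preimage_on (gdom gc) (gphi gc)); exact/dopen_euclE.
  apply: (dsmooth_on_comp (Y := eucl R _) (E := setT) _ _ (@dsmooth_rsub _ _ _ _)) => //.
  apply: (dsmooth_on_comp (Y := eucl R _) (F := c) (E := U) _ _ sphiE) => [x []//|].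
  by apply: dsmooth_on_sub (gphi gc) => x [].
- split.
    apply: (dopen_preimage_on _ srow); last exact/dopen_euclE.
    apply: (dopen_preimage (X := prod_space Z (eucl R k)) (F := fst) _ (gdom gd)).
    by move=> n V p [].
  apply: (@dsmooth_on_comp R (prod_space Z (eucl R k)) (eucl R _) X _ (chart_img c)
    (psi \o row) (chart_inv c) _ _ (gpsi gc)); first by move=> p [_ /hW[/UU0[]]].
  apply: (@dsmooth_on_comp R (prod_space Z (eucl R k)) (eucl R _) (eucl R _) _ W row psi _ _ spsiE).
    by move=> p [].
  by apply: dsmooth_on_sub srow => p [].
- move=> z w [/= dz /hW[Up E]]; have [cp _] := UU0 _ Up.
  have Dp : D (chart_inv c (psi (row (z, w)))).
    by split; [exact: chart_invP|rewrite chart_invK].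
  have [dp] := lD _ Dp; rewrite chart_invK// E row_mxKr row_mxKl => dE; split=> //.
  by rewrite -(chart_mapK dp) -dE chart_mapK.
- move=> x Dx; have [dx l] := lD _ Dx; have [cx' /hU[Wp pK]] := Dx.
  by rewrite /row/= -l hsubmxK pK chart_mapK.
Qed.
End Manifolds.

(** * Pullbacks along submersions *)

Section FibreProducts.
Variable R : realType.
Implicit Types X Y Z M S : diffspace R.

(** Let [S] be, near [x0], the pullback of the submersion [f : M -> Z] along the
    plot [gam], in the sense that [(al, be)] and [mu] are inverse bijections
    between [N] and the set of all [(v, h)] with [V v] and [f h = gam v].  Where
    [f] is a projection with fibre coordinate [rho], the pair [(v, rho h)] is then
    a coordinate system on [S].  Presenting [S] by these maps lets it be a fibre
    product as well as a bibundle. *)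
Lemma pullback_chart S M Z (A : atlas R M) (B : atlas R Z) (f : M -> Z)
    n (V : set 'rV[R]_n) (gam : 'rV[R]_n -> Z) (N : set S)
    (al : S -> 'rV[R]_n) (be : S -> M) (mu : 'rV[R]_n * M -> S) (x0 : S) :
  manifold_structure A -> manifold_structure B -> diff_smooth f -> submersion A B f ->
  plot V gam -> dopen N -> N x0 ->
  dsmooth_on (Y := eucl R n) N al -> dsmooth_on N be ->
  dsmooth_on (X := prod_space (eucl R n) M) (fun p => V p.1 /\ f p.2 = gam p.1) mu ->
  (forall x, N x -> [/\ V (al x), f (be x) = gam (al x) & mu (al x, be x) = x]) ->
  (forall v h, V v -> f h = gam v -> [/\ N (mu (v, h)), al (mu (v, h)) = v & be (mu (v, h)) = h]) ->
  exists n' D (W : set 'rV[R]_n') phi psi, gchart (X := S) D W phi psi /\ D x0.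
Proof.
move=> mA mB sf subf Vgam oN Nx0 sal sbe smu hN hmu.
have [k [D [rho [E [sec [[oD Dx0 srho] [oE ssec] hE hD]]]]]] :=
  submersion_local_product (be x0) mA mB sf subf.
have [oV sgam] := (plotE V gam).1 Vgam.
exists (n + k)%N, (fun x => N x /\ D (be x)).
pose gw (w : 'rV[R]_(n + k)) : Z * 'rV[R]_k := (gam (lsubmx w), rsubmx w).
exists (fun w => V (lsubmx w) /\ E (gw w)).
exists (fun x => row_mx (al x) (rho (be x))), (fun w => mu (lsubmx w, sec (gw w))).
split; last by split.
have sgw : dsmooth_on (X := eucl R (n + k)) (Y := prod_space Z (eucl R k))
    (fun w => V (lsubmx w)) gw.
  apply: dsmooth_pair; last exact: dsmooth_rsub.
  apply: (@dsmooth_on_comp R (eucl R _) (eucl R _) Z _ V lsubmx gam _ _ sgam) => //.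
  exact: dsmooth_lsub.
split.
- exact: dopen_preimage_on.
- apply/dopen_euclE; apply: (dopen_preimage_on _ sgw oE).
  apply: (@dopen_preimage R (eucl R (n + k)) (eucl R n) lsubmx); last exact/dopen_euclE.
  by move=> l U p pU; apply: (@dsmooth_lsub R n k setT l U p pU).
- apply: dsmooth_row; first by apply: dsmooth_on_sub sal => x [].
  apply: (@dsmooth_on_comp R S M (eucl R k) _ D be rho) => //; first by move=> x [].
  by apply: dsmooth_on_sub sbe => x [].
- apply: (@dsmooth_on_comp R (eucl R _) (prod_space (eucl R n) M) S _ _
      (fun w => (lsubmx w, sec (gw w))) mu _ _ smu).
    by move=> w [Vw Ew] /=; have [_ ->] := hE _ _ Ew.
  apply: dsmooth_pair; first exact: dsmooth_lsub.
  apply: (@dsmooth_on_comp R (eucl R _) (prod_space Z (eucl R k)) M _ E gw sec) => //.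
    by move=> w [].
  by apply: dsmooth_on_sub sgw => w [].
- move=> x [Nx Dx]; have [Vx fx mx] := hN x Nx; rewrite /gw /= row_mxKl row_mxKr -fx.
  by split=> //; have [] := hD _ Dx.
- move=> w [Vw Ew]; have [D1w fw rw] := hE _ _ Ew.
  by have [? _ ->] := hmu _ _ Vw fw.
- move=> x [Nx Dx]; have [Vx fx mx] := hN x Nx; rewrite /gw /= row_mxKl row_mxKr -fx.
  by have [_ ->] := hD _ Dx.
- move=> w [Vw Ew]; have [D1w fw rw] := hE _ _ Ew.
  by have [_ -> ->] := hmu _ _ Vw fw; rewrite rw hsubmxK.
Qed.

(** A smooth local retraction onto [P] is a left inverse of the inclusion.  So the
    inclusion is an immersion, and an open subset of [P] is the trace of its
    preimage under the retraction. *)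
Lemma embedded_of_retraction M (A : atlas R M) (P : M -> Prop) :
  manifold_structure A -> manifold_structure (good_atlas (sub_space P)) ->
  (forall z : sub_space P, exists N rho, [/\ dopen N, N (sval z),
     dsmooth_on (Y := sub_space P) N rho & forall z', N (sval z') -> rho (sval z') = z']) ->
  embedded_structure A (good_atlas (sub_space P)).
Proof.
move=> mA mP H.
have sv : diff_smooth (X := sub_space P) (Y := M) (@sval M P) by move=> n U p.
have smap := diff_smooth_map mP mA sv.
split; first exact: mP.1.
- split=> // c d x Ac Bd cx dfx.
  have [N [rho [oN Nx srho rhoK]]] := H x.
  have [oW1 s1] := coord_rep_smooth mP mA Ac Bd (@dopenT _ (sub_space P)) (diff_smooth_on sv).
  have [oW2 s2] := coord_rep_smooth mA mP Bd Ac oN srho.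
  set W1 := (X in open X) in oW1 s1; set W2 := (X in open X) in oW2 s2.
  have cE : chart_inv c (c x) = x by rewrite chart_mapK.
  have dE : chart_inv d (d (sval x)) = sval x by rewrite chart_mapK.
  have W1x : W1 (c x) by split; [exact: chart_mapP|rewrite /preimage/= cE].
  have W2x : W2 (coord_rep c d (@sval M P) (c x)).
    rewrite /coord_rep /= cE.
    by split; [exact: chart_mapP|rewrite /preimage/= dE rhoK].
  have oW : open (W1 `&` (coord_rep c d (@sval M P)) @^-1` W2).
    by apply: open_preimage_on => // y; exact: smooth_on_continuous s1.
  apply: (can_inj (g := 'd (c \o rho \o chart_inv d) (coord_rep c d (@sval M P) (c x)))).
  apply: (diff_left_inverse oW) => //.
  + move=> y [[cy [_ dy]] [_ [N1 _]]]; move: N1.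
    rewrite /coord_rep/= chart_mapK// => N1.
    by rewrite rhoK ?chart_invK.
  + exact: (smooth_on_differentiable oW1 s1).
  + exact: (smooth_on_differentiable oW2 s2).
- move=> Q; split=> [/(dopen_atlas _ mP) oQ|[Q' /(dopen_atlas _ mA) oQ' ->]]; last first.
    by apply/(dopen_atlas _ mP); exact: (dopen_preimage sv).
  (* The largest open set whose trace is contained in [Q]. *)
  pose F (T : set M) := dopen T /\ (forall z : sub_space P, T (sval z) -> Q z).
  exists (\bigcup_(T in F) T : set (atlas_space A)).
    apply: bigcup_open => T [oT _]; exact/(dopen_atlas _ mA).
  apply/seteqP; split=> [z Qz|z [T [_ TQ] /TQ//]].
  have [N [rho [oN Nz srho rhoK]]] := H z.
  exists (fun x => N x /\ Q (rho x)).
    by split=> [|z' [Nz']]; [exact: dopen_preimage_on|rewrite rhoK].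
  by split=> //; rewrite rhoK.
Qed.

Lemma prod_manifold X Y (A : atlas R X) (B : atlas R Y) :
  manifold_structure A -> manifold_structure B ->
  manifold_structure (X := prod_space X Y) (prod_atlas A B).
Proof.
move=> mA mB; apply: manifold_of_gcharts; last first.
  move=> [x y]; have [c Ac cx] := mA.1.1 x; have [d Bd dy] := mB.1.1 y.
  by exists (prod_chart c d) => //; exists c, d.
move=> _ [c [d [/(gchart_of_manifold mA) gc /(gchart_of_manifold mB) gd ->]]].
split.
- have sfst : diff_smooth (X := prod_space X Y) (Y := X) fst by move=> n U p [].
  have ssnd : diff_smooth (X := prod_space X Y) (Y := Y) snd by move=> n U p [].
  exact: (dopen_preimage_on (dopen_preimage sfst (gdom gc)) (diff_smooth_on ssnd) (gdom gd)).
- exact: chart_open.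
- apply: dsmooth_row.
    apply: (@dsmooth_on_comp R (prod_space X Y) X (eucl R _) _ _ fst c _ _ (gphi gc)).
      by move=> z [].
    exact: dsmooth_fst.
  apply: (@dsmooth_on_comp R (prod_space X Y) Y (eucl R _) _ _ snd d _ _ (gphi gd)).
    by move=> z [].
  exact: dsmooth_snd.
- apply: dsmooth_pair.
    apply: (@dsmooth_on_comp R (eucl R _) (eucl R _) X _ _ lsubmx (chart_inv c) _ _ (gpsi gc)).
      by move=> z [].
    exact: dsmooth_lsub.
  apply: (@dsmooth_on_comp R (eucl R _) (eucl R _) Y _ _ rsubmx (chart_inv d) _ _ (gpsi gd)).
    by move=> z [].
  exact: dsmooth_rsub.
- exact: (@chart_mapP _ _ (prod_chart c d)).
- exact: (@chart_invP _ _ (prod_chart c d)).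
- exact: (@chart_mapK _ _ (prod_chart c d)).
- exact: (@chart_invK _ _ (prod_chart c d)).
Qed.

Section Pairing.
Variables (X Y Z : diffspace R) (f : X -> Z) (g : Y -> Z).

(** Total version of [fpair], with a default value, so that maps into the fibre
    product can be built from functions without carrying proofs of the matching
    condition. *)
Definition fpair_tot (z0 : fibprod f g) (p : X * Y) : fibprod f g :=
  if pselect (f p.1 = g p.2) is left e then fpair e else z0.

Lemma fpair_eq (x : X) (y : Y) (e e' : f x = g y) : fpair e = fpair e'.
Proof. by rewrite (Prop_irrelevance e e'). Qed.

Lemma fpair_sval (z : fibprod f g) : z = fpair (svalP z).
Proof. by case: z => -[x y] e /=; exact: fpair_eq. Qed.

Lemma fpair_totE z0 x y (e : f x = g y) : fpair_tot z0 (x, y) = fpair e.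
Proof. by rewrite /fpair_tot/=; case: pselect => [e'|/(_ e)//]; exact: fpair_eq. Qed.

Lemma fpair_tot_sval z0 p : f p.1 = g p.2 -> sval (fpair_tot z0 p) = p.
Proof. by case: p => x y /= e; rewrite (fpair_totE _ e). Qed.

Lemma fpair_tot_smooth z0 :
  dsmooth_on (X := prod_space X Y) (fun p => f p.1 = g p.2) (fpair_tot z0).
Proof.
move=> n U p pU Up; apply: (@plot_ext R (prod_space X Y) n U p _ _ pU) => u Uu.
by rewrite /= fpair_tot_sval//; exact: Up.
Qed.

(** A total extension of a smooth map on the fibre product is smooth where the
    matching condition holds.  The default value that [fpair_tot] requires is
    obtained from a point of the domain of the plot, the claim being local there;
    the fibre product may be empty otherwise. *)
Lemma fib_ext_smooth S (F : fibprod f g -> S) (G : X * Y -> S) : diff_smooth F ->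
  (forall x y (e : f x = g y), G (x, y) = F (fpair e)) ->
  dsmooth_on (X := prod_space X Y) (fun p => f p.1 = g p.2) G.
Proof.
move=> sF GF n U p pU Up; apply: plot_locally => u0 Uu0.
exists U; split=> //.
have := @dsmooth_on_comp _ _ _ _ _ setT _ _ (fun _ _ => I) (@fpair_tot_smooth (fpair (Up _ Uu0)))
  (diff_smooth_on sF) _ _ _ pU Up.
apply: plot_ext => u Uu /=; have := Up u Uu; case: (p u) => x y /= e.
by rewrite (fpair_totE _ e) GF.
Qed.
End Pairing.

(** Charts come from [pullback_chart], with the inverse of a chart of [Y] as plot of
    the base.  The retraction sends [(x, y)] to [(x', y)], where [x'] is obtained
    from [x] by keeping the fibre coordinate [rho] and moving to the fibre of [f]
    over [g y]; it fixes the pairs with [f x = g y]. *)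
Lemma fibprod_submersion X Y Z (A : atlas R X) (B : atlas R Y) (C : atlas R Z)
    (f : X -> Z) (g : Y -> Z) :
  manifold_structure A -> manifold_structure B -> manifold_structure C ->
  diff_smooth f -> diff_smooth g -> submersion A C f ->
  manifold_structure (good_atlas (fibprod f g)) /\
  fibprod_structure A B (good_atlas (fibprod f g)).
Proof.
move=> mA mB mC sf sg subf.
have sfst : diff_smooth (X := prod_space X Y) (Y := X) fst by move=> n U p [].
have ssnd : diff_smooth (X := prod_space X Y) (Y := Y) snd by move=> n U p [].
have sffst : diff_smooth (@ffst _ _ _ _ f g) by move=> n U p [].
have sfsnd : diff_smooth (@fsnd _ _ _ _ f g) by move=> n U p [].
have mP : manifold_structure (good_atlas (fibprod f g)).
  apply: good_atlas_manifold => z0.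
  have [n [D [W [phi [psi [gy Dy]]]]]] := manifold_gchart (fsnd z0) mB.
  apply: (@pullback_chart _ X Z A C f n W (g \o psi) (fun z => D (fsnd z))
    (fun z => phi (fsnd z)) (@ffst _ _ _ _ f g)
    (fun p => fpair_tot z0 (p.2, psi p.1)) z0) => //.
  - exact: sg (gchart_plot gy).
  - exact: (dopen_preimage sfsnd (gdom gy)).
  - apply: (@dsmooth_on_comp R _ Y (eucl R n) _ D (@fsnd _ _ _ _ f g) phi _ _ (gphi gy)) => //.
    exact: diff_smooth_on.
  - exact: diff_smooth_on.
  - apply: (@dsmooth_on_comp R (prod_space (eucl R n) X) (prod_space X Y) _ _ _
      (fun p => (p.2, psi p.1)) _ _ _ (fpair_tot_smooth z0)).
      by move=> p [].
    apply: dsmooth_pair; first exact: dsmooth_snd.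
    apply: (@dsmooth_on_comp R (prod_space (eucl R n) X) (eucl R n) Y _ W fst psi _ _ (gpsi gy)).
      by move=> p [].
    exact: dsmooth_fst.
  - move=> z Dz; have e := svalP z; rewrite /= (gphiK gy Dz).
    split=> //; first exact: (gphiW gy Dz).
    by rewrite [RHS]fpair_sval (fpair_totE _ (svalP z)).
  - move=> v h Wv /= e; rewrite (fpair_totE _ e) /fsnd/ffst/=.
    by rewrite (gpsiK gy Wv); split=> //; exact: (gpsiD gy Wv).
split=> //; apply: (@embedded_of_retraction (prod_space X Y) (prod_atlas A B)
  (fun z : X * Y => f z.1 = g z.2)) => //; first exact: prod_manifold.
move=> z0.
have [k [D [rho [E [sec [[oD Dx0 srho] [oE ssec] hE hD]]]]]] :=
  submersion_local_product (ffst z0) mA mC sf subf.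
pose gw (p : X * Y) : Z * 'rV[R]_k := (g p.2, rho p.1).
exists (fun p : X * Y => D p.1 /\ E (gw p)), (fun p => fpair_tot z0 (sec (gw p), p.2)).
have sgw : dsmooth_on (X := prod_space X Y) (Y := prod_space Z (eucl R k)) (fun p => D p.1) gw.
  apply: dsmooth_pair; first by apply: diff_smooth_on => n U p [_]; exact: sg.
  apply: (@dsmooth_on_comp R (prod_space X Y) X (eucl R k) _ D fst rho) => //.
  exact: dsmooth_fst.
split.
- exact: (dopen_preimage_on (dopen_preimage sfst oD) sgw oE).
- split=> //; rewrite /gw -(svalP z0); by have [] := hD _ Dx0.
- apply: (@dsmooth_on_comp R (prod_space X Y) (prod_space X Y) _ _ _
      (fun p => (sec (gw p), p.2)) _ _ _ (fpair_tot_smooth z0)).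
    by move=> p [_ /hE[_]].
  apply: dsmooth_pair; last exact: dsmooth_snd.
  apply: (@dsmooth_on_comp R (prod_space X Y) (prod_space Z (eucl R k)) X _ E gw sec) => //.
    by move=> p [].
  by apply: dsmooth_on_sub sgw => p [].
- move=> z [Dz _]; rewrite /gw -(svalP z); have [_ ->] := hD _ Dz.
  by rewrite [RHS]fpair_sval (fpair_totE _ (svalP z)).
Qed.
End FibreProducts.

(** * Principal bibundles over Lie groupoids *)

Section Bibundles.
Variable R : realType.

Section Bibundle.
Variables (G H : diff_groupoid R) (X : bibundle G H).

(** Total versions of the two actions; the value outside the domain is chosen so that
    the invariance of the other anchor holds unconditionally. *)
Definition ract_tot (p : X * arr H) : X :=
  if pselect (ranchor X p.1 = tgt p.2) is left e then ract X (fpair e) else p.1.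

Definition lact_tot (p : arr G * X) : X :=
  if pselect (src p.1 = lanchor X p.2) is left e then lact X (fpair e) else p.2.

Lemma ract_totE x h (e : ranchor X x = tgt h) : ract_tot (x, h) = ract X (fpair e).
Proof.
by rewrite /ract_tot/=; case: pselect => [e'|/(_ e)//]; rewrite (fpair_eq e' e).
Qed.

Lemma lact_totE g x (e : src g = lanchor X x) : lact_tot (g, x) = lact X (fpair e).
Proof.
by rewrite /lact_tot/=; case: pselect => [e'|/(_ e)//]; rewrite (fpair_eq e' e).
Qed.

Lemma ract_tot_smooth : dsmooth_on (X := prod_space X (arr H))
  (fun p => ranchor X p.1 = tgt p.2) ract_tot.
Proof. exact: fib_ext_smooth (@ract_smooth _ _ _ X) ract_totE. Qed.

Lemma lact_tot_smooth : dsmooth_on (X := prod_space (arr G) X)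
  (fun p => src p.1 = lanchor X p.2) lact_tot.
Proof. exact: fib_ext_smooth (@lact_smooth _ _ _ X) lact_totE. Qed.

Lemma lanchor_ract_tot x h : lanchor X (ract_tot (x, h)) = lanchor X x.
Proof. by rewrite /ract_tot; case: pselect => //= e; rewrite lanchor_ract. Qed.

Lemma ranchor_lact_tot g x : ranchor X (lact_tot (g, x)) = ranchor X x.
Proof. by rewrite /lact_tot; case: pselect => //= e; rewrite ranchor_lact. Qed.

(** The second component of the inverse of the shear map: [dv (x, y)] is the unique
    arrow [h] with [x h = y]. *)
Lemma right_division : diffeomorphism (@rshear R G H X) ->
  exists dv : X * X -> arr H,
    [/\ dsmooth_on (X := prod_space X X) (fun p => lanchor X p.1 = lanchor X p.2) dv,
      (forall x y, lanchor X x = lanchor X y ->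
         ranchor X x = tgt (dv (x, y)) /\ ract_tot (x, dv (x, y)) = y) &
      (forall x h, ranchor X x = tgt h -> dv (x, ract_tot (x, h)) = h)].
Proof.
move=> [_ [F' sF' [K K']]].
pose dv (p : X * X) : arr H :=
  if pselect (lanchor X p.1 = lanchor X p.2) is left e then fsnd (F' (fpair e))
  else unt (ranchor X p.1).
have dvE x y (e : lanchor X x = lanchor X y) : dv (x, y) = fsnd (F' (fpair e)).
  by rewrite /dv/=; case: pselect => [e'|/(_ e)//]; rewrite (fpair_eq e' e).
exists dv; split.
- by apply: (fib_ext_smooth (F := fun z => fsnd (F' z))) => // n U p /sF'[].
- move=> x y e; rewrite (dvE _ _ e); have E := K' (fpair e).
  have /= E1 := congr1 (fun z => (sval z).1) E.
  have /= E2 := congr1 (fun z => (sval z).2) E.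
  move: E1 E2 (svalP (F' (fpair e))); rewrite /ffst /fsnd.
  case: (F' (fpair e)) => -[x' h] /= e' <- <- _; split=> //.
  by rewrite (ract_totE e').
- move=> x h e; rewrite (ract_totE e).
  have e' : lanchor X x = lanchor X (ract X (fpair e)) by rewrite lanchor_ract.
  rewrite (dvE _ _ e') (fpair_eq e' (esym (lanchor_ract (fpair e)))).
  by have := K (fpair e); rewrite /rshear /= => ->.
Qed.

Lemma left_division : diffeomorphism (@lshear R G H X) ->
  forall x y, ranchor X x = ranchor X y ->
    exists2 g, src g = lanchor X x & lact_tot (g, x) = y.
Proof.
move=> [_ [F' _ [_ K']]] x y e.
have E := K' (fpair (esym e)).
have /= E1 := congr1 (fun z => (sval z).1) E.
have /= E2 := congr1 (fun z => (sval z).2) E.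
move: E1 E2; rewrite /ffst /fsnd; case: (F' (fpair (esym e))) => -[g x'] /= e' <- <-.
by exists g => //; rewrite (lact_totE e').
Qed.
End Bibundle.

(** A subduction onto a manifold lifts the inverse of a chart, locally. *)
Lemma subduction_section (X Z : diffspace R) (B : atlas R Z) (F : X -> Z) (z : Z) :
  manifold_structure B -> subduction F ->
  exists N s, [/\ dopen N, N z, dsmooth_on N s & forall z', N z' -> F (s z') = z'].
Proof.
move=> mB [_ _ Fq].
have [n [D [W [phi [psi [g Dz]]]]]] := manifold_gchart z mB.
have [C WC CP] := Fq _ _ _ (gchart_plot g).
have : W (phi z) by exact: (gphiW g Dz).
rewrite WC => -[V CV Vz]; have [oV [q pq qE]] := CP V CV.
exists (fun z' => D z' /\ V (phi z')), (q \o phi); split.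
- apply: (@dopen_preimage_on R Z (eucl R n) D phi V).
  + exact: gdom g.
  + exact: gphi g.
  + exact/dopen_euclE.
- by [].
- apply: (@dsmooth_on_comp R Z (eucl R n) X _ V phi q).
  + by move=> z' [].
  + by apply: dsmooth_on_sub (gphi g) => z' [].
  + by have [] := (plotE V q).1 pq.
- by move=> z' [Dz' Vz'] /=; rewrite -qE// (gphiK g Dz').
Qed.

(** Keep the fibre coordinate of [h] constant. *)
Lemma submersion_section (M Z : diffspace R) (A : atlas R M) (B : atlas R Z)
    (f : M -> Z) (h : M) :
  manifold_structure A -> manifold_structure B -> diff_smooth f -> submersion A B f ->
  exists N s, [/\ dopen N, N (f h), dsmooth_on N s, s (f h) = h & forall z', N z' -> f (s z') = z'].
Proof.
move=> mA mB sf subf.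
have [k [D [rho [E [sec [[oD Dx0 srho] [oE ssec] hE hD]]]]]] :=
  submersion_local_product h mA mB sf subf.
have si : diff_smooth (X := Z) (Y := prod_space Z (eucl R k)) (fun z => (z, rho h)).
  move=> n U p pU; split; first exact: pU.
  by apply: plot_cst; exact: plot_open pU.
have [Eh mvh] := hD _ Dx0.
exists (fun z => E (z, rho h)), (fun z => sec (z, rho h)); split=> //.
- exact: (dopen_preimage si oE).
- apply: (@dsmooth_on_comp R Z (prod_space Z (eucl R k)) M _ E (fun z => (z, rho h)) sec) => //.
  exact: diff_smooth_on.
- by move=> z' /hE[].
Qed.
End Bibundles.

Theorem corollary6p9 (R : realType) (G H : lie_groupoid R) (X : bibundle G H)
    (hX : biprincipal X) : lie_biprincipal X.
Proof.
have [[subr shl] [subl shr]] := hX.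
have mG0 := obj_manifold G; have mH0 := obj_manifold H.
have mG1 := arr_manifold G; have mH1 := arr_manifold H.
have sl := @lanchor_smooth _ _ _ X; have sr := @ranchor_smooth _ _ _ X.
have [dv [sdv dvP dvK]] := right_division shr.
(* Over the domain of a section [sg] of the left anchor, [x |-> dv (sg (l x), x)]
   identifies [X] with the pullback of the target map of [H] along [r \o sg]. *)
have mX : manifold_structure (good_atlas X).
  apply: good_atlas_manifold => x0.
  have [N [sg [oN Nx ssg lsg]]] := subduction_section (lanchor X x0) mG0 subl.
  have [n [D [W [phi [psi [g Dx]]]]]] := manifold_gchart (lanchor X x0) mG0.
  pose V w := W w /\ N (psi w).
  have oV : open V.
    apply/dopen_euclE; apply: (dopen_preimage_on _ (gpsi g) oN); exact/dopen_euclE/(gimg g).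
  have ssV : dsmooth_on (X := eucl R n) V (fun w => sg (psi w)).
    apply: (@dsmooth_on_comp R (eucl R n) (obj G) X _ N psi sg) => // [w []//|].
    by apply: dsmooth_on_sub (gpsi g) => w [].
  apply: (@pullback_chart _ X (arr H) (obj H) (arr_atlas H) (obj_atlas H) (@tgt R H) n V
    (fun w => ranchor X (sg (psi w)))
    (fun x => D (lanchor X x) /\ N (lanchor X x))
    (fun x => phi (lanchor X x)) (fun x => dv (sg (lanchor X x), x))
    (fun p => ract_tot (sg (psi p.1), p.2)) x0) => //.
  - exact: tgt_smooth.
  - exact: tgt_submersion.
  - apply/plotE; split=> //.
    apply: (@dsmooth_on_comp R (eucl R n) X (obj H) _ setT _ (ranchor X)) => //.
    exact: diff_smooth_on.
  - apply: (dopen_preimage_on (dopen_preimage sl (gdom g)) (diff_smooth_on sl) oN).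
  - apply: (@dsmooth_on_comp R X (obj G) (eucl R n) _ D (lanchor X) phi _ _ (gphi g)).
      by move=> x [].
    exact: diff_smooth_on.
  - apply: (@dsmooth_on_comp R X (prod_space X X) (arr H) _ _
      (fun x => (sg (lanchor X x), x)) dv _ _ sdv).
      by move=> x [_ /lsg].
    apply: dsmooth_pair; last exact: dsmooth_id.
    apply: (@dsmooth_on_comp R X (obj G) X _ N (lanchor X) sg) => //; first by move=> x [].
    exact: diff_smooth_on.
  - apply: (@dsmooth_on_comp R (prod_space (eucl R n) (arr H)) (prod_space X (arr H)) X _ _
      (fun p => (sg (psi p.1), p.2)) (@ract_tot _ _ _ X) _ _ (@ract_tot_smooth _ _ _ X)).
      by move=> p [_ /esym].
    apply: dsmooth_pair; last exact: dsmooth_snd.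
    apply: (@dsmooth_on_comp R (prod_space (eucl R n) (arr H)) (eucl R n) X _ V fst
      (fun w => sg (psi w)) _ _ ssV).
      by move=> p [].
    exact: dsmooth_fst.
  - move=> x [Dlx Nlx]; have [e1 e2] := dvP _ _ (lsg _ Nlx).
    rewrite /V /= (gphiK g Dlx); split=> //.
    by split=> //; exact: (gphiW g Dlx).
  - move=> v h [Wv Nv] /= e.
    have E : lanchor X (ract_tot (sg (psi v), h)) = psi v by rewrite lanchor_ract_tot lsg.
    rewrite E (gpsiK g Wv); split=> //; first by split=> //; exact: (gpsiD g Wv).
    by rewrite dvK.
(* A section through [x]: the section [sg] of the left anchor, corrected by
   a section [tau] of the target map through the arrow [h] that takes
   [sg (l x)] to [x]. *)
have subml : submersion (good_atlas X) (obj_atlas G) (lanchor X).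
  apply: submersion_of_sections => // x.
  have [N [sg [oN Nx ssg lsg]]] := subduction_section (lanchor X x) mG0 subl.
  have [e1 e2] := dvP _ _ (lsg _ Nx); set h := dv _ in e1 e2.
  have [T [tau [oT Th stau tauh tT]]] :=
    submersion_section h mH1 mH0 (@tgt_smooth _ H) (tgt_submersion H).
  have srg : dsmooth_on N (fun z => ranchor X (sg z)).
    by apply: (@dsmooth_on_comp R (obj G) X (obj H) _ setT) ssg (diff_smooth_on sr).
  exists (fun z => N z /\ T (ranchor X (sg z))).
  exists (fun z => ract_tot (sg z, tau (ranchor X (sg z)))); split.
  - exact: dopen_preimage_on.
  - by rewrite e1.
  - apply: (@dsmooth_on_comp R (obj G) (prod_space X (arr H)) X _ _
      (fun z => (sg z, tau (ranchor X (sg z)))) (@ract_tot _ _ _ X) _ _ (@ract_tot_smooth _ _ _ X)).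
      by move=> z [_ /tT].
    apply: dsmooth_pair; first by apply: dsmooth_on_sub ssg => z [].
    apply: (@dsmooth_on_comp R (obj G) (obj H) (arr H) _ T
      (fun z => ranchor X (sg z)) tau _ _ stau); first by move=> z [].
    by apply: dsmooth_on_sub srg => z [].
  - by rewrite e1 tauh.
  - by move=> z [Nz _]; rewrite lanchor_ract_tot lsg.
(* The mirror image, with the left action and the source map of [G]. *)
have submr : submersion (good_atlas X) (obj_atlas H) (ranchor X).
  apply: submersion_of_sections => // x.
  have [N [sg [oN Nx ssg rsg]]] := subduction_section (ranchor X x) mH0 subr.
  have [g e1 e2] := left_division shl (rsg _ Nx).
  have [T [tau [oT Tg stau taug tT]]] :=
    submersion_section g mG1 mG0 (@src_smooth _ G) (src_submersion G).
  have slg : dsmooth_on N (fun z => lanchor X (sg z)).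
    by apply: (@dsmooth_on_comp R (obj H) X (obj G) _ setT) ssg (diff_smooth_on sl).
  exists (fun z => N z /\ T (lanchor X (sg z))).
  exists (fun z => lact_tot (tau (lanchor X (sg z)), sg z)); split.
  - exact: dopen_preimage_on.
  - by rewrite -e1.
  - apply: (@dsmooth_on_comp R (obj H) (prod_space (arr G) X) X _ _
      (fun z => (tau (lanchor X (sg z)), sg z)) (@lact_tot _ _ _ X) _ _ (@lact_tot_smooth _ _ _ X)).
      by move=> z [_ /tT].
    apply: dsmooth_pair; last by apply: dsmooth_on_sub ssg => z [].
    apply: (@dsmooth_on_comp R (obj H) (obj G) (arr G) _ T
      (fun z => lanchor X (sg z)) tau _ _ stau); first by move=> z [].
    by apply: dsmooth_on_sub slg => z [].
  - by rewrite -e1 taug.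
  - by move=> z [Nz _]; rewrite ranchor_lact_tot rsg.
have [mAL fAL] := fibprod_submersion mG1 mX mG0 (@src_smooth _ G) sl (src_submersion G).
have [mAR fAR] := fibprod_submersion mX mH1 mH0 sr (@tgt_smooth _ H) submr.
have [mBL fBL] := fibprod_submersion mX mX mH0 sr sr submr.
have [mBR fBR] := fibprod_submersion mX mX mG0 sl sl subml.
exists (good_atlas X) => //; split.
- by split=> //; case: subl.
- by split=> //; case: subr.
exists (good_atlas _), (good_atlas _), (good_atlas _), (good_atlas _); split.
- by split.
- exact: diff_smooth_map mAL mX (@lact_smooth _ _ _ X).
- exact: diff_smooth_map mAR mX (@ract_smooth _ _ _ X).
- exact: diffeo_manifold mAR mBR shr.
- exact: diffeo_manifold mAL mBL shl.
Qed.
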